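(* Let $\varrho$ be a control function, and let $(X,d,\mu)$ and $(X',d',\mu')$ be quasiconvex uniform metric measure spaces that support a local weak $(1,1)$-Poincar\'e inequality. If $(X,d)$ and $(X',d')$ are quasi-isometric, then $(X,d,\mu)$ satisfies $(S_{1,1}^\varrho)$ if and only if $(X',d',\mu')$ satisfies $(S_{1,1}^\varrho)$.
   Context: A metric measure space $(X,d,\mu)$ is a metric space $(X,d)$ with a Borel regular outer measure $\mu$ such that $\mu(X)>0$ and $\mu(B(x,r))<\infty$ for all $x\in X$, $r>0$; $B(x,r)$ denotes the open ball. It is quasiconvex if there is $Q\ge 1$ such that any $x,y\in X$ are joined by a rectifiable path of length at most $Q\,d(x,y)$. It is uniform if there are non-decreasing functions $f,g\colon(0,\infty)\to(0,\infty)$ with $f(r)\le\mu(B(x,r))\le g(r)$ for all $x\in X$ and $0<r<\infty$. Upper gradients: a Borel function $g\colon X\to[0,\infty]$ is an upper gradient of $u$ if $|u(\gamma(a))-u(\gamma(b))|\le\int_\gamma g\,ds$ for every rectifiable path $\gamma\colon[a,b]\to X$, and a $1$-weak upper gradient if this holds for all rectifiable paths outside a family of $1$-modulus zero. $N^{1,1}(X,d,\mu)$ is the Newton-Sobolev space of (equivalence classes of) integrable functions $u\colon X\to[-\infty,\infty]$ having an integrable upper gradient, and $|\nabla u|$ is the minimal $1$-weak upper gradient of $u$. The space supports a local weak $(1,1)$-Poincar\'e inequality (up to scale $R_P$) if there are $C_P,R_P>0$ and $\tau\ge1$ such that for all balls $B(x,r)\subseteq X$ with $0<r\le R_P$ one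 has $0<\mu(B(x,\tau r))<\infty$ and $$\frac1{\mu(B(x,r))}\int_{B(x,r)}|u-u_{B(x,r)}|\,d\mu\le C_P\,r\,\frac1{\mu(B(x,\tau r))}\int_{B(x,\tau r)}g_u\,d\mu$$ for every $u\colon X\to\mathbb R$ with $u\in L^1(B(x,\tau r),d,\mu)$, where $g_u\colon X\to[0,\infty]$ is its minimal $1$-weak upper gradient and $u_A=\frac1{\mu(A)}\int_A u\,d\mu$. A control function is a non-decreasing $\varrho\colon[0,\infty)\to[0,\infty)$ with $\varrho(0)=1$ for which there are functions $L,M\colon(0,\infty)\to(0,\infty)$ with $\varrho(\varepsilon+t)\le L(\varepsilon)\varrho(t)$ and $\varrho(\varepsilon t)\le M(\varepsilon)\varrho(t)$ for all $t,\varepsilon>0$. $(X,d,\mu)$ satisfies $(S_{1,1}^\varrho)$ if there exist $C>0$ and $o\in X$ such that $\int_X|u|\,d\mu\le C\int_X|\nabla u|\,\varrho(d(o,\cdot))\,d\mu$ for every $u\in N^{1,1}(X,d,\mu)$ with bounded support. $(X,d)$ and $(X',d')$ are quasi-isometric if there are $f\colon X\to X'$ and constants $\lambda\ge1$, $\kappa\ge0$ such that $\lambda^{-1}d(x,y)-\kappa\le d'(f(x),f(y))\le\lambda d(x,y)+\kappa$ for all $x,y\in X$, and $f(X)\subseteq X'$ is $\kappa$-cobounded, i.e. $\{x'\in X': d'(x',f(X))<\kappa\}=X'$. *)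

(* Defs.v *)
From HB Require Import structures.
From mathcomp Require Import all_boot all_order all_algebra.
From mathcomp Require Import all_classical all_reals all_analysis.
From mathcomp Require Import measurable_realfun.

Set Implicit Arguments.
Unset Strict Implicit.
Unset Printing Implicit Defensive.

Import Order.TTheory GRing.Theory Num.Theory.
Import numFieldNormedType.Exports.

Local Open Scope classical_set_scope.
Local Open Scope ring_scope.

(* The measurable types of the library are pointed, hence the base point; it
   plays no other role, a metric measure space being nonempty as [0 < mu X]. *)
#[short(type="pmetricType")]
HB.structure Definition PointedMetric (R : numDomainType) :=
  { M of PseudoPointedMetric R M & PseudoMetric_isMetric R M }.

Section RectifiablePaths.
Context {R : realType} (X : metricType R).

Definition curve_length (gamma : R -> X) (a b : R) : \bar R :=
  ereal_sup [set (\sum_(0 <= n < size s)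
                    mdist (gamma (nth b (a :: s) n))
                          (gamma (nth b (a :: s) n.+1)))%:E
            | s in itv_partition a b].

(* Only the values of [rpath_fun] on [rpath_start, rpath_end] matter. *)
Record rpath := RPath {
  rpath_fun :> R -> X ;
  rpath_start : R ;
  rpath_end : R ;
  rpath_le : rpath_start <= rpath_end ;
  rpath_continuous : {within `[rpath_start, rpath_end], continuous rpath_fun} ;
  rpath_rectifiable :
    (curve_length rpath_fun rpath_start rpath_end < +oo)%E }.

Definition rpath_length (gamma : rpath) : \bar R :=
  curve_length gamma (rpath_start gamma) (rpath_end gamma).

(* The arc-length parametrization: [gamma] factors through
   [t |-> curve_length gamma (rpath_start gamma) t], so the value does not
   depend on the parameter picked by [xget]. *)
Definition arc_param (gamma : rpath) (s : R) : X :=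
  gamma (xget (rpath_start gamma)
    [set t | rpath_start gamma <= t <= rpath_end gamma
           /\ curve_length gamma (rpath_start gamma) t = s%:E]).

Definition line_integral (gamma : rpath) (g : X -> \bar R) : \bar R :=
  (\int[lebesgue_measure]_(s in `[0%R, fine (rpath_length gamma)])
     g (arc_param gamma s))%E.

Definition quasiconvex : Prop :=
  exists2 Q : R, 1 <= Q & forall x y : X, exists gamma : rpath,
    [/\ gamma (rpath_start gamma) = x, gamma (rpath_end gamma) = y
      & (rpath_length gamma <= (Q * mdist x y)%:E)%E].

End RectifiablePaths.

Section MetricMeasureSpaces.
Context {R : realType} {X : pmetricType R}.
Local Open Scope ereal_scope.

Definition borel_set (B : set X) : Prop := <<s (@open X) >> B.

Definition borel_fun (g : X -> \bar R) : Prop :=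
  measurable_fun setT (g : g_sigma_algebraType (@open X) -> \bar R).

Variable mu : {outer_measure set X -> \bar R}.

(* [mu] restricted to its Caratheodory sigma-algebra. *)
Definition cara_measure : {measure set (caratheodory_type mu) -> \bar R} :=
  (mu : set (caratheodory_type mu) -> \bar R).

Definition borel_regular : Prop :=
  (forall B, borel_set B -> mu.-caratheodory B) /\
  (forall A, exists B, [/\ borel_set B, A `<=` B & mu B = mu A]).

Definition metric_measure_space : Prop :=
  [/\ borel_regular, 0 < mu [set: X]
    & forall (x : X) (r : R), (0 < r)%R -> mu (ball x r) < +oo].

Definition uniform_mms : Prop :=
  exists f g : R -> R,
    [/\ forall r, (0 < r)%R -> (0 < f r)%R /\ (0 < g r)%R,
        forall r s, (0 < r)%R -> (r <= s)%R ->
          (f r <= f s)%R /\ (g r <= g s)%R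
      & forall (x : X) r, (0 < r)%R ->
          (f r)%:E <= mu (ball x r) /\ mu (ball x r) <= (g r)%:E].

(* When one of the two values of [u] is infinite, the left-hand side evaluates
   to [+oo] in [\bar R] (also for [+oo - +oo]), which is the usual convention. *)
Definition upper_gradient_along (u g : X -> \bar R) (gamma : rpath X) : Prop :=
  `|u (gamma (rpath_start gamma)) - u (gamma (rpath_end gamma))|
    <= line_integral gamma g.

(* Constant paths impose no condition on a real-valued [u]; they are left out
   as an extended real-valued [u] would otherwise be forced to be finite. *)
Definition upper_gradient (u g : X -> \bar R) : Prop :=
  [/\ borel_fun g, forall x, 0 <= g x
    & forall gamma, 0 < rpath_length gamma -> upper_gradient_along u g gamma].

Definition modulus1 (Gamma : set (rpath X)) : \bar R :=
  ereal_inf [set \int[cara_measure]_x rho x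
            | rho in [set rho : X -> \bar R |
                [/\ borel_fun rho, forall x, 0 <= rho x
                  & forall gamma, Gamma gamma ->
                      1 <= line_integral gamma rho]]].

Definition weak_upper_gradient (u g : X -> \bar R) : Prop :=
  [/\ borel_fun g, forall x, 0 <= g x
    & exists2 Gamma : set (rpath X), modulus1 Gamma = 0
      & forall gamma, 0 < rpath_length gamma -> ~ Gamma gamma ->
          upper_gradient_along u g gamma].

Definition loc_integrable (g : X -> \bar R) : Prop :=
  forall x : X, exists2 r : R, (0 < r)%R &
    \int[cara_measure]_(y in ball x r) g y < +oo.

(* Minimality is meaningful only among locally integrable competitors: a
   non-integrable weak upper gradient can be infinite on a set that meets every
   path in positive length, and arbitrary elsewhere. *)
Definition min_weak_upper_gradient (u g : X -> \bar R) : Prop :=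
  [/\ weak_upper_gradient u g, loc_integrable g
    & forall g', weak_upper_gradient u g' -> loc_integrable g' ->
        {ae cara_measure, forall x, g x <= g' x}].

(* Representatives of the classes in the Newton-Sobolev space. *)
Definition newton_sobolev11 (u : X -> \bar R) : Prop :=
  cara_measure.-integrable [set: X] u /\
  exists2 g, upper_gradient u g & cara_measure.-integrable [set: X] g.

Definition bounded_support (u : X -> \bar R) : Prop :=
  exists (x : X) (r : R), closure [set y | u y != 0] `<=` ball x r.

Definition avg (A : set X) (f : X -> \bar R) : \bar R :=
  (mu A)^-1 * \int[cara_measure]_(x in A) f x.

Definition local_weak_poincare11 : Prop :=
  exists CP RP tau : R, [/\ (0 < CP)%R, (0 < RP)%R, (1 <= tau)%R &
    forall (x : X) (r : R), (0 < r <= RP)%R ->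
      0 < mu (ball x (tau * r)%R) < +oo /\
      forall (u : X -> R) (gu : X -> \bar R),
        cara_measure.-integrable (ball x (tau * r)%R) (EFin \o u) ->
        min_weak_upper_gradient (EFin \o u) gu ->
        avg (ball x r)
          (fun y => `|u y - fine (avg (ball x r) (EFin \o u))|%R%:E)
        <= (CP * r)%:E * avg (ball x (tau * r)%R) gu].

Definition sobolev11 (rho : R -> R) : Prop :=
  exists (C : R) (o : X), (0 < C)%R /\
    forall u gu : X -> \bar R,
      newton_sobolev11 u -> bounded_support u ->
      min_weak_upper_gradient u gu ->
      \int[cara_measure]_x `|u x|
        <= C%:E * \int[cara_measure]_x (gu x * (rho (mdist o x))%:E).

End MetricMeasureSpaces.

(* [rho] stands for a function on [0, +oo); its values elsewhere are junk. *)
Definition control_function {R : realType} (rho : R -> R) : Prop :=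
  [/\ forall t, 0 <= t -> 0 <= rho t,
      forall s t, 0 <= s -> s <= t -> rho s <= rho t,
      rho 0 = 1
    & exists L M : R -> R,
        (forall e, 0 < e -> 0 < L e /\ 0 < M e) /\
        (forall t e, 0 < t -> 0 < e ->
           rho (e + t) <= L e * rho t /\ rho (e * t) <= M e * rho t)].

Definition quasi_isometric {R : realType} (X X' : metricType R) : Prop :=
  exists (f : X -> X') (lambda kappa : R),
    [/\ 1 <= lambda, 0 <= kappa,
        forall x y : X,
          lambda^-1 * mdist x y - kappa <= mdist (f x) (f y) /\
          mdist (f x) (f y) <= lambda * mdist x y + kappa
      & [set x' : X' | inf [set mdist x' y | y in range f] < kappa] = setT].

(* Main.v *)
Require Import Defs.
From mathcomp Require Import all_boot all_order all_algebra.
From mathcomp Require Import all_classical all_reals all_analysis.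
From mathcomp Require Import measurable_realfun.
From mathcomp Require Import ring lra.

Set Implicit Arguments.
Unset Strict Implicit.
Unset Printing Implicit Defensive.

Import Order.TTheory GRing.Theory Num.Theory.
Import numFieldNormedType.Exports.

Local Open Scope classical_set_scope.
Local Open Scope ring_scope.

(* Let [h : X' -> X] be a quasi-isometry and let [u] on [X] be given. Its averages
   [a z] over balls of a fixed radius centred at [h z], for [z] in a finite
   1-separated net of a large ball of [X'], are interpolated by a Lipschitz
   partition of unity into a compactly supported [v] on [X']. Since [X] is
   quasiconvex, chaining the local Poincare inequality along paths bounds
   [|a z - a z'|] for neighbouring [z, z'] by the integral of [|nabla u|] over a
   ball around [h z] of fixed radius; hence [v] has an explicit upper gradient
   whose weighted integral is at most a constant times that of [|nabla u|], the
   overlaps being bounded by uniformity. Up to such terms, [int |u|] and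
   [int |v|] are both comparable to the sum of the [|a z|], so the inequality for
   [v] gives the one for [u].
   The inequality on [X'] only speaks of minimal weak upper gradients, so one must
   know that [v] has one: as [p = 1], it is the limit of a decreasing minimizing
   sequence, provided that the minimum of two weak upper gradients is again one. *)

(** * Length of curves and arc-length parametrization *)

(** A quasi-isometry need not be continuous or even measurable, so [u] cannot be composed with it;
    only the numbers [a z] are carried over. The constants must not depend on [u], although the net
    depends on its support: they count separated points in balls of fixed radius, which uniformity
    bounds irrespective of the centre. The weight is transported because a control function grows by
    at most a constant factor when its argument is replaced by an affine function of it, and because
    the base point on [X] is the image [h p'] of the one on [X']; as the weight is at least 1,
    unweighted error terms are absorbed too. Minimality is tested against weak upper gradients that
    are merely locally integrable, so minima with such functions are needed; separability, itself a
    consequence of uniformity, shows that almost every path still has a finite integral against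
    them. Exceptional families are encoded by one integrable density, a form inherited by subpaths.
    Both implications are instances of one transfer, applied to a map and to its quasi-inverse. *)

Section CurveLength.
Context {R : realType} {X : metricType R}.
Implicit Types (gamma : R -> X) (a b c s t : R) (l : seq R).

Fixpoint polygon_length gamma a l : R :=
  if l is x :: l' then mdist (gamma a) (gamma x) + polygon_length gamma x l'
  else 0.

Lemma polygon_lengthE gamma a b l :
  \sum_(0 <= n < size l) mdist (gamma (nth b (a :: l) n))
                               (gamma (nth b (a :: l) n.+1))
  = polygon_length gamma a l.
Proof.
elim: l a => [|x l IH] a; first by rewrite big_nil.
by rewrite /= big_nat_recl//= -IH.
Qed.

Lemma curve_lengthE gamma a b : curve_length gamma a b =
  ereal_sup [set (polygon_length gamma a l)%:E | l in itv_partition a b].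
Proof.
by congr ereal_sup; apply/seteqP; split => _ [l lab <-]; exists l => //;
  rewrite (polygon_lengthE gamma a b).
Qed.

Lemma polygon_length_ge0 gamma a l : 0 <= polygon_length gamma a l.
Proof. by elim: l a => //= x l IH a; rewrite addr_ge0// mdist_ge0. Qed.

Lemma polygon_length_cat gamma a l1 l2 : polygon_length gamma a (l1 ++ l2) =
  polygon_length gamma a l1 + polygon_length gamma (last a l1) l2.
Proof. by elim: l1 a => [|x l IH] a /=; rewrite ?add0r// IH addrA. Qed.

(** Inserting the vertex [c] can only lengthen the polygon, by the triangle inequality in the cell
    that contains [c]. *)
Lemma polygon_length_split gamma a c l : path <%R a l -> a <= c ->
  polygon_length gamma a l <=
    polygon_length gamma a (itv_partitionL l c) +
    polygon_length gamma c (itv_partitionR l c).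
Proof.
elim: l a => [|x l IH] a /=.
  by move=> _ ac; rewrite addr_ge0// addr_ge0// mdist_ge0.
move=> /andP[ax xl] ac; rewrite /itv_partitionL/itv_partitionR/=.
have xlm : all (fun y => x < y) l.
  exact: (order_path_min lt_trans xl).
case: (ltP x c) => [xc|cx] /=.
  rewrite (ltNge c x) (ltW xc)/= -addrA lerD2l; exact: IH (ltW xc).
rewrite (_ : [seq y <- l | y < c] = [::]); last first.
  rewrite -(filter_pred0 l); apply: eq_in_filter => y yl.
  by rewrite ltNge (le_trans cx)// ltW// (allP xlm).
rewrite (_ : [seq y <- l | c < y] = l); last first.
  apply/all_filterP/allP => y yl; rewrite (le_lt_trans cx)//.
  exact: (allP xlm).
rewrite /= addr0; case: ltP => [_|xc] /=.
  rewrite addrA lerD2r; exact: metric_triangle.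
by have -> : c = x by apply/eqP; rewrite eq_le cx xc.
Qed.

Lemma curve_length_ge_polygon gamma a b l : itv_partition a b l ->
  ((polygon_length gamma a l)%:E <= curve_length gamma a b)%E.
Proof.
by move=> abl; rewrite curve_lengthE; apply: ereal_sup_ubound; exists l.
Qed.

Lemma itv_partition_exists a b : a <= b -> exists l, itv_partition a b l.
Proof.
rewrite le_eqVlt => /predU1P[->|ab]; first by exists [::]; split => /=.
by exists [:: b]; exact: itv_partition1.
Qed.

Lemma curve_length_ge0 gamma a b : a <= b -> (0 <= curve_length gamma a b)%E.
Proof.
move=> /itv_partition_exists[l abl].
apply: le_trans (curve_length_ge_polygon gamma abl).
by rewrite lee_fin polygon_length_ge0.
Qed.

Lemma curve_length_ge_mdist gamma a b : a <= b ->
  ((mdist (gamma a) (gamma b))%:E <= curve_length gamma a b)%E.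
Proof.
rewrite le_eqVlt => /predU1P[->|ab].
  by rewrite mdistxx curve_length_ge0.
apply: le_trans (curve_length_ge_polygon gamma (itv_partition1 ab)).
by rewrite /= addr0.
Qed.

Lemma curve_lengthxx gamma a : curve_length gamma a a = 0%E.
Proof.
rewrite curve_lengthE (_ : itv_partition a a = [set [::]]).
  by rewrite image_set1 ereal_sup1.
apply/seteqP; split => l /=; first exact: itv_partitionxx.
by move=> ->; split => /=.
Qed.

Lemma curve_lengthD gamma a c b : a <= c -> c <= b ->
  curve_length gamma a b =
    (curve_length gamma a c + curve_length gamma c b)%E.
Proof.
rewrite le_eqVlt => /predU1P[<-|ac]; first by rewrite curve_lengthxx add0e.
rewrite le_eqVlt => /predU1P[->|cb]; first by rewrite curve_lengthxx adde0.
apply/eqP; rewrite eq_le; apply/andP; split.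
  rewrite curve_lengthE; apply: ge_ereal_sup => _ [l abl <-].
  have [al _] := abl.
  apply: (@le_trans _ _ (polygon_length gamma a (itv_partitionL l c) +
      polygon_length gamma c (itv_partitionR l c))%:E).
    by rewrite lee_fin; exact/polygon_length_split/ltW.
  rewrite EFinD; apply: leeD; apply: curve_length_ge_polygon.
    exact: itv_partitionLP abl.
  exact: itv_partitionRP abl.
have H l1 l2 : itv_partition a c l1 -> itv_partition c b l2 ->
  ((polygon_length gamma a l1)%:E + (polygon_length gamma c l2)%:E <=
    curve_length gamma a b)%E.
  move=> acl cbl; have := itv_partition_cat acl cbl.
  move=> /(curve_length_ge_polygon gamma); apply: le_trans.
  by rewrite polygon_length_cat -EFinD lee_fin; case: acl => _ /eqP ->.
(* The two suprema are taken one after the other, each by moving the other term across the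
   inequality; this needs finite values, hence the separate infinite case. *)
have [inf|fin] := eqVneq (curve_length gamma a b) +oo%E; first by rewrite inf leey.
have H1 l1 : itv_partition a c l1 ->
   (curve_length gamma c b <=
      curve_length gamma a b - (polygon_length gamma a l1)%:E)%E.
  move=> acl; rewrite {1}curve_lengthE; apply: ge_ereal_sup => _ [l2 cbl <-].
  by rewrite leeBrDl// H.
have cbfin : curve_length gamma c b \is a fin_num.
  have [l1 acl] := itv_partition_exists (ltW ac).
  rewrite ge0_fin_numE ?curve_length_ge0 ?ltW//.
  apply: le_lt_trans (H1 _ acl) _.
  by rewrite -EFinN lte_add_pinfty// ltey.
rewrite -leeBrDr// {1}curve_lengthE; apply: ge_ereal_sup => _ [l1 acl <-].
by rewrite leeBrDr// addeC -leeBrDr// H1.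
Qed.

(* For a partition of [x, b] almost realizing the length, inserting [y] in its
   first cell shows that the length of [x, y] is at most
   [mdist (gamma x) (gamma y)] up to the error. *)
Lemma curve_length_right_small gamma x b (e : R) : x < b -> 0 < e ->
  (curve_length gamma x b < +oo)%E ->
  exists2 p, x < p <= b & forall y, x <= y -> y <= p ->
    (curve_length gamma x y <= (mdist (gamma x) (gamma y) + e)%:E)%E.
Proof.
move=> xb e0 fin.
have fn : curve_length gamma x b \is a fin_num.
  by rewrite ge0_fin_numE// curve_length_ge0// ltW.
have := fn; rewrite {1}curve_lengthE => /(ub_ereal_sup_adherent e0)[_ [l xbl <-]].
rewrite -curve_lengthE => H.
case: l xbl H => [/itv_partition_nil xb'|p l xbl H]; first by rewrite xb' ltxx in xb.
have pbl := itv_partition_cons xbl.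
have [/= /andP[xp _] _] := xbl.
exists p; first by rewrite xp (itv_partition_le pbl).
move=> y xy yp.
have yb : y <= b by rewrite (le_trans yp)// (itv_partition_le pbl).
have yfn : curve_length gamma y b \is a fin_num.
  rewrite ge0_fin_numE ?curve_length_ge0//.
  apply: le_lt_trans fin; rewrite (curve_lengthD gamma xy yb).
  by rewrite leeDr// curve_length_ge0.
have := H; rewrite (curve_lengthD gamma xy yb) lteBlDr// => {}H.
have : (polygon_length gamma x (p :: l) <=
    mdist (gamma x) (gamma y) + (mdist (gamma y) (gamma p) + polygon_length gamma p l))%R.
  by rewrite /= addrA lerD2r metric_triangle.
move=> H1.
have H2 : ((mdist (gamma y) (gamma p) + polygon_length gamma p l)%:E <=
    curve_length gamma y b)%E.
  move: (yp); rewrite le_eqVlt => /predU1P[->|yp'].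
    by rewrite mdistxx add0r; exact: curve_length_ge_polygon.
  by apply: (@curve_length_ge_polygon gamma y b (p :: l)); case: pbl => /= *;
    split => //=; rewrite yp'.
rewrite -(@leeD2rE _ (curve_length gamma y b))//.
apply: le_trans (ltW H) _; rewrite -EFinD.
move: H1; rewrite -(lerD2r e) -lee_fin => /le_trans; apply.
by rewrite addrAC EFinD leeD2lE.
Qed.

(** Mirror image of [curve_length_right_small]: [y] is inserted in the last cell of an almost
    optimal partition. *)
Lemma curve_length_left_small gamma a x (e : R) : a < x -> 0 < e ->
  (curve_length gamma a x < +oo)%E ->
  exists2 p, a <= p < x & forall y, p <= y -> y <= x ->
    (curve_length gamma y x <= (mdist (gamma y) (gamma x) + e)%:E)%E.
Proof.
move=> ax e0 fin.
have fn : curve_length gamma a x \is a fin_num.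
  by rewrite ge0_fin_numE// curve_length_ge0// ltW.
have := fn; rewrite {1}curve_lengthE => /(ub_ereal_sup_adherent e0)[_ [l axl <-]].
rewrite -curve_lengthE => H.
case/lastP: l axl H => [/itv_partition_nil xb'|l z]; first by rewrite xb' ltxx in ax.
move=> [pl /eqP]; rewrite last_rcons => zx; rewrite {z}zx in pl *.
move: pl; rewrite rcons_path => /andP[pl px] H; set p := last a l in px.
have apl : itv_partition a p l by split.
exists p; first by rewrite px (itv_partition_le apl).
move=> y py yx.
have ay : a <= y by rewrite (le_trans (itv_partition_le apl)).
have yfn : curve_length gamma a y \is a fin_num.
  rewrite ge0_fin_numE ?curve_length_ge0//.
  apply: le_lt_trans fin; rewrite (curve_lengthD gamma ay yx).
  by rewrite leeDl// curve_length_ge0.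
have := H; rewrite (curve_lengthD gamma ay yx) lteBlDr// => {}H.
have H1 : (polygon_length gamma a (rcons l x) <=
    (polygon_length gamma a l + mdist (gamma p) (gamma y)) + mdist (gamma y) (gamma x))%R.
  rewrite -cats1 polygon_length_cat /= addr0 -addrA lerD2l; exact: metric_triangle.
have H2 : ((polygon_length gamma a l + mdist (gamma p) (gamma y))%:E <=
    curve_length gamma a y)%E.
  move: (py); rewrite le_eqVlt => /predU1P[<-|py'].
    by rewrite mdistxx addr0; exact: curve_length_ge_polygon.
  rewrite (_ : _ + _ = polygon_length gamma a (rcons l y)).
    apply: curve_length_ge_polygon; split; last by rewrite last_rcons.
    by rewrite rcons_path pl.
  by rewrite -cats1 polygon_length_cat /= addr0.
rewrite -(@leeD2lE _ (curve_length gamma a y))//.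
apply: le_trans (ltW H) _; rewrite -EFinD.
move: H1; rewrite -(lerD2r e) -lee_fin => /le_trans; apply.
by rewrite -addrA !EFinD leeD2rE ?fin_numD.
Qed.

End CurveLength.

(** * Arc length along a rectifiable path *)

Section ArcLength.
Context {R : realType} {X : metricType R}.
Variable gamma : rpath X.
Let a := rpath_start gamma.
Let b := rpath_end gamma.
Implicit Types (s t : R).

Definition arc_length t : R := fine (curve_length gamma a t).
Local Notation V := arc_length.

Lemma rpath_continuousP t (e : R) : a <= t <= b -> 0 < e ->
  exists2 d, 0 < d & forall s, a <= s <= b -> `|t - s| < d ->
    mdist (gamma t) (gamma s) < e.
Proof.
move=> tab e0; have /subspace_continuousP/(_ t) C := @rpath_continuous _ _ gamma.
have /C {}C : `[rpath_start gamma, rpath_end gamma]%classic t by rewrite /= in_itv.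
have nb : nbhs (gamma t) [set y | mdist (gamma t) y < e].
  by rewrite -ballEmdist; exact: nbhsx_ballx.
have [d d0 H] := C _ nb.
exists d => // s sab ts; exact: (H s).
Qed.

Lemma rpath_length_fin s t : a <= s -> s <= t -> t <= b ->
  curve_length gamma s t \is a fin_num.
Proof.
move=> as_ st tb; rewrite ge0_fin_numE ?curve_length_ge0//.
apply: le_lt_trans (rpath_rectifiable gamma).
rewrite -/a -/b (curve_lengthD gamma as_ (le_trans st tb)).
rewrite (curve_lengthD gamma st tb) addeCA leeDl//.
by rewrite adde_ge0 ?curve_length_ge0// (le_trans st).
Qed.

Lemma arc_lengthB s t : a <= s -> s <= t -> t <= b ->
  curve_length gamma s t = (V t - V s)%:E.
Proof.
move=> as_ st tb; rewrite /V (curve_lengthD gamma as_ st).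
have f1 := rpath_length_fin as_ st tb.
have f2 := rpath_length_fin (lexx a) as_ (le_trans st tb).
by rewrite fineD// addrAC subrr add0r fineK.
Qed.

Lemma arc_length_le s t : a <= s -> s <= t -> t <= b -> V s <= V t.
Proof.
move=> as_ st tb; rewrite -subr_ge0 -lee_fin -arc_lengthB//.
exact: curve_length_ge0.
Qed.

Lemma mdist_arc_length s t : a <= s <= b -> a <= t <= b ->
  mdist (gamma s) (gamma t) <= `|V s - V t|.
Proof.
wlog st : s t / s <= t.
  move=> H sab tab; have [|/ltW ts] := leP s t; first by move=> /H; apply.
  by rewrite metric_sym distrC H.
move=> /andP[as_ sb] /andP[at_ tb].
rewrite distrC ger0_norm ?subr_ge0 ?arc_length_le// -lee_fin -arc_lengthB//.
exact: curve_length_ge_mdist.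
Qed.

Lemma arc_length_start : V a = 0.
Proof. by rewrite /V curve_lengthxx. Qed.

Lemma rpath_lengthE : rpath_length gamma = (V b)%:E.
Proof.
have ab := rpath_le gamma.
by rewrite /rpath_length -/a -/b arc_lengthB// arc_length_start subr0.
Qed.

(** Intermediate value argument at [t0], the supremum of the parameters of arc length at most [s].
    The two one-sided lemmas convert the continuity of [gamma] into that of its arc length. *)
Lemma arc_length_surj s : 0 <= s <= V b -> exists2 t, a <= t <= b & V t = s.
Proof.
move=> /andP[s0 sV].
have ab : a <= b := rpath_le gamma.
pose A := [set t | a <= t <= b /\ V t <= s].
have Aa : A a by split; rewrite ?lexx ?ab// arc_length_start.
have hsA : has_sup A.
  by split; [exists a|exists b => t [/andP[]]].
pose t0 := sup A.
have at0 : a <= t0 by apply: ub_le_sup => //; exact: hsA.2.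
have t0b : t0 <= b by apply: ge_sup => [|t [/andP[]]//]; exists a.
have t0ab : a <= t0 <= b by rewrite at0.
(* If the value at [t0] exceeded [s], a parameter of [A] just left of [t0] would be closer in arc
   length than the gap; if it were below [s], a parameter right of [t0] would still belong to [A].
   In both cases half of the gap goes to the distance and half to the error of the partition. *)
exists t0 => //; apply/eqP; rewrite eq_le; apply/andP; split.
  rewrite leNgt; apply/negP => Vs.
  have e0 : 0 < (V t0 - s) / 2 by rewrite divr_gt0// subr_gt0.
  have [at0'|t0a] := ltP a t0; last first.
    have t0a' : t0 = a by apply/eqP; rewrite eq_le t0a.
    by move: Vs; rewrite t0a' arc_length_start ltNge s0.
  have fin : (curve_length gamma a t0 < +oo)%E.
    by rewrite -ge0_fin_numE ?curve_length_ge0// rpath_length_fin.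
  have [p /andP[ap pt0] Hp] := curve_length_left_small at0' e0 fin.
  have [d d0 Hd] := rpath_continuousP t0ab e0.
  have m0 : 0 < Num.min d (t0 - p) by rewrite lt_min d0 subr_gt0.
  have [y [/andP[ay yb] Vy]] := sup_adherent m0 hsA.
  rewrite -/t0 ltrBlDl -ltrBlDr lt_min => /andP[yd yp].
  have yt0 : y <= t0.
    by apply: ub_le_sup; [exact: hsA.2|split; rewrite ?ay].
  have py : p <= y by lra.
  have := Hp y py yt0; rewrite arc_lengthB// lee_fin.
  have := Hd y; rewrite ay yb ger0_norm ?subr_ge0// => /(_ isT yd).
  rewrite metric_sym; lra.
rewrite leNgt; apply/negP => Vs.
have e0 : 0 < (s - V t0) / 2 by rewrite divr_gt0// subr_gt0.
have t0b' : t0 < b.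
  rewrite lt_neqAle t0b andbT; apply: contraL sV => /eqP t0E.
  by rewrite -ltNge -t0E.
have fin : (curve_length gamma t0 b < +oo)%E.
  by rewrite -ge0_fin_numE ?curve_length_ge0// rpath_length_fin.
have [p /andP[t0p pb] Hp] := curve_length_right_small t0b' e0 fin.
have [d d0 Hd] := rpath_continuousP t0ab e0.
pose y := Num.min (t0 + d / 2) p.
have t0y : t0 < y by rewrite lt_min t0p andbT ltrDl divr_gt0.
have yp : y <= p by rewrite ge_min lexx orbT.
have yd : y <= t0 + d / 2 by rewrite ge_min lexx.
have yb : y <= b by rewrite (le_trans yp).
have ay : a <= y by rewrite (le_trans at0)// ltW.
have := Hp y (ltW t0y) yp; rewrite (arc_lengthB at0 (ltW t0y) yb) lee_fin.
have := Hd y; rewrite ay yb distrC ger0_norm ?subr_ge0 ?(ltW t0y)// => /(_ isT).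
have -> : y - t0 < d by lra.
move=> /(_ isT) H1 H2.
have : A y by split; rewrite ?ay//; lra.
by move=> /(ub_le_sup hsA.2); rewrite -/t0 leNgt t0y.
Qed.

(** The parameter picked by [xget] may differ from [t], but both have the same arc length, so the
    distance of their images is 0. *)
Lemma arc_paramE t : a <= t <= b -> arc_param gamma (V t) = gamma t.
Proof.
move=> tab; have /andP[at_ tb] := tab; rewrite /arc_param.
have [] := @xgetPex _ (rpath_start gamma)
  [set t' | a <= t' <= b /\ curve_length gamma a t' = (V t)%:E] _.
  by exists t; split => //; rewrite /V fineK// rpath_length_fin.
rewrite -/a; set t' := xget _ _ => t'ab; move=> Vt'; apply: mdist_positivity.
have := mdist_arc_length t'ab tab.
have -> : V t' = V t by rewrite {1}/V Vt'.
rewrite subrr normr0 => H; apply/eqP; rewrite eq_le H; exact: mdist_ge0.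
Qed.

End ArcLength.

Section ArcParam.
Context {R : realType} {X : metricType R}.

Lemma clamp_lip (L s t : R) : 0 <= L ->
  `|Num.max 0 (Num.min s L) - Num.max 0 (Num.min t L)| <= `|s - t|.
Proof.
move=> L0; wlog st : s t / s <= t.
  move=> H; have [|/ltW ts] := leP s t; first exact: H.
  by rewrite distrC (distrC s) H.
have mono : Num.max 0 (Num.min s L) <= Num.max 0 (Num.min t L).
  by rewrite ge_max !le_max lexx/= le_min !ge_min st lexx !orbT.
rewrite distrC (distrC s) !ger0_norm ?subr_ge0//.
rewrite lerBlDr ge_max addr_ge0 ?subr_ge0 ?le_max ?lexx//=.
apply: (@le_trans _ _ (t - s + Num.min s L)); last by rewrite lerD2l le_max lexx orbT.
rewrite ge_min; case: (leP s L) => sL; first by rewrite subrK lexx.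
by rewrite lerDr subr_ge0 st orbT.
Qed.

(* Clamping the parameter makes the arc-length parametrization 1-Lipschitz on
   the whole line. *)
Definition arc_param_clamp (gamma : rpath X) (s : R) : X :=
  arc_param gamma (Num.max 0 (Num.min s (fine (rpath_length gamma)))).

Lemma fine_rpath_length_ge0 (gamma : rpath X) : 0 <= fine (rpath_length gamma).
Proof. by rewrite fine_ge0// curve_length_ge0// rpath_le. Qed.

Lemma arc_param_clampE (gamma : rpath X) (s : R) :
  0 <= s <= fine (rpath_length gamma) ->
  arc_param_clamp gamma s = arc_param gamma s.
Proof. by move=> /andP[s0 sL]; rewrite /arc_param_clamp min_l// max_r. Qed.

Lemma arc_param_clampV (gamma : rpath X) (t : R) :
  rpath_start gamma <= t <= rpath_end gamma ->
  arc_param_clamp gamma (arc_length gamma t) = gamma t.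
Proof.
move=> tab; rewrite arc_param_clampE ?arc_paramE//.
have /andP[at_ tb] := tab.
rewrite rpath_lengthE/= arc_length_le// andbT.
by rewrite -(arc_length_start gamma) arc_length_le.
Qed.

Lemma arc_param_clamp_lip (gamma : rpath X) (s t : R) :
  mdist (arc_param_clamp gamma s) (arc_param_clamp gamma t) <= `|s - t|.
Proof.
have clampP r : 0 <= Num.max 0 (Num.min r (fine (rpath_length gamma)))
    <= fine (rpath_length gamma).
  rewrite le_max lexx/= ge_max fine_rpath_length_ge0/=.
  by rewrite ge_min lexx orbT.
have : `|Num.max 0 (Num.min s (fine (rpath_length gamma))) -
    Num.max 0 (Num.min t (fine (rpath_length gamma)))| <= `|s - t|.
  exact/clamp_lip/fine_rpath_length_ge0.
apply: le_trans.
rewrite /arc_param_clamp.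
have := clampP s; have := clampP t.
move: (Num.max _ _) (Num.max _ _) => t' s'.
rewrite rpath_lengthE/= => /arc_length_surj[y yab <-] /arc_length_surj[x xab <-].
by rewrite !arc_paramE//; exact: mdist_arc_length.
Qed.

End ArcParam.

(** * Line integrals and subpaths *)

Section LineIntegral.
Context {R : realType} {X : pmetricType R}.
Implicit Types (gamma : rpath X) (g : X -> \bar R).
Local Notation lebesgue := (@lebesgue_measure R).

Lemma lipschitz1_continuous (eta : R -> X) :
  (forall s t, mdist (eta s) (eta t) <= `|s - t|) -> continuous eta.
Proof.
move=> lip s; apply/cvg_ballP => e e0.
near=> t; rewrite ballEmdist/=; apply: le_lt_trans (lip s t) _.
near: t; exists e => //.
Unshelve. all: by end_near. Qed.

Lemma borel_fun_comp (eta : R -> X) g : continuous eta -> borel_fun g ->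
  measurable_fun [set: R] (g \o eta).
Proof.
move=> ceta bg.
have meta : measurable_fun [set: R] (eta : R -> g_sigma_algebraType (@open X)).
  apply: (@measurability _ _ _ (g_sigma_algebraType (@open X)) _ _ (@open X)) => // _ [U oU <-].
  rewrite setTI; apply: open_measurable.
  by move/continuousP : ceta; apply.
exact: (measurableT_comp bg meta).
Qed.

Lemma lebesgue_measure_shift (c : R) (A : set R) : measurable A ->
  pushforward lebesgue ((fun r => c + r) : _ -> measurableTypeR R) A
    = lebesgue A.
Proof.
move=> mA; apply/esym/lebesgue_measure_unique => //=.
  exact: measurable_funD.
move=> mc _ [[x y]] _ <-.
rewrite /pushforward (_ : _ @^-1` _ = `]x - c, y - c]%classic); last first.
  apply/seteqP; split => r /=; rewrite !in_itv/= => /andP[? ?]; apply/andP; split; lra.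
rewrite !lebesgue_measure_itv/= !lte_fin ltrD2r; case: ifPn => // _.
by rewrite -!EFinB; congr EFin; lra.
Qed.


Lemma ge0_integral_shift (k : R -> \bar R) (c x y : R) :
  measurable_fun [set: R] k -> (forall r, 0 <= k r)%E ->
  (\int[lebesgue]_(r in `[x, y]) k (c + r)%R =
   \int[lebesgue]_(r in `[(c + x)%R, (c + y)%R]) k r)%E.
Proof.
move=> mk k0.
have -> : (`[x, y]%classic : set R) =
    ((fun r => c + r) : _ -> measurableTypeR R) @^-1` `[c + x, c + y]%classic.
  by apply/seteqP; split => r /=; rewrite !in_itv/= !lerD2l.
have mc : measurable_fun [set: measurableTypeR R]
    ((fun r => c + r) : _ -> measurableTypeR R) by exact: measurable_funD.
rewrite -[LHS](@ge0_integral_pushforward _ _ _ _ _ _ mc _ _ k)//.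
  by apply: eq_measure_integral => A mA _; exact: lebesgue_measure_shift.
exact: measurable_funTS.
Qed.

Lemma line_integralE gamma g : line_integral gamma g =
  (\int[lebesgue]_(s in `[0%R, fine (rpath_length gamma)])
    g (arc_param_clamp gamma s))%E.
Proof.
apply: eq_integral => s; rewrite inE/= in_itv/= => s0L.
by rewrite arc_param_clampE.
Qed.

Lemma arc_param_clamp_start gamma :
  arc_param_clamp gamma 0 = gamma (rpath_start gamma).
Proof.
by rewrite -(arc_length_start gamma) arc_param_clampV// lexx rpath_le.
Qed.

Lemma arc_param_clamp_end gamma :
  arc_param_clamp gamma (fine (rpath_length gamma)) = gamma (rpath_end gamma).
Proof. by rewrite rpath_lengthE/= arc_param_clampV// lexx rpath_le. Qed.

Lemma measurable_fun_arc gamma g : borel_fun g ->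
  measurable_fun [set: R] (g \o arc_param_clamp gamma).
Proof.
move=> bg; apply: borel_fun_comp => //; apply: lipschitz1_continuous.
exact: arc_param_clamp_lip.
Qed.

(** The subpath is [gamma] restricted to parameters of arc length [s] and [t]. Its arc-length
    parametrization is that of [gamma] shifted by [s], so translation invariance of Lebesgue measure
    identifies the integrals. An inequality along subpaths thus becomes one on all subintervals of a
    fixed segment. *)
Lemma subpath_exists gamma (s t : R) :
  0 <= s -> s <= t -> t <= fine (rpath_length gamma) ->
  exists gamma' : rpath X, [/\ rpath_length gamma' = (t - s)%:E,
    gamma' (rpath_start gamma') = arc_param_clamp gamma s,
    gamma' (rpath_end gamma') = arc_param_clamp gamma t &
    forall g, borel_fun g -> (forall x, 0 <= g x)%E ->
      line_integral gamma' g =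
        (\int[lebesgue]_(r in `[s, t]) g (arc_param_clamp gamma r))%E].
Proof.
move=> s0 st; rewrite {1}rpath_lengthE/= => tL.
have [x xab xs] : exists2 x, rpath_start gamma <= x <= rpath_end gamma &
    arc_length gamma x = s.
  by apply: arc_length_surj; rewrite s0 (le_trans st).
have [y yab yt] : exists2 y, rpath_start gamma <= y <= rpath_end gamma &
    arc_length gamma y = t.
  by apply: arc_length_surj; rewrite (le_trans s0 st).
have /andP[ax xb] := xab; have /andP[ay yb] := yab.
(* The two parameters are obtained independently; by monotonicity they can be in the wrong order
   only if [s = t], and then one of them serves for both. *)
wlog xy : x y xab yab ax xb ay yb xs yt / x <= y.
  move=> H; have [xy|/ltW yx] := leP x y; first exact: (H x y).
  have ts : t = s.
    by apply/eqP; rewrite eq_le st andbT -xs -yt arc_length_le.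
  by apply: (H x x) => //; rewrite xs.
have gc : {within `[x, y], continuous gamma}.
  apply: continuous_subspaceW (rpath_continuous (r := gamma)).
  by move=> z /=; rewrite !in_itv/= => /andP[xz zy]; rewrite (le_trans ax)// (le_trans zy).
have gr : (curve_length gamma x y < +oo)%E.
  by rewrite -ge0_fin_numE ?curve_length_ge0// rpath_length_fin.
pose gamma' := RPath xy gc gr; exists gamma'.
have Lg' : rpath_length gamma' = (t - s)%:E.
  by rewrite /rpath_length/= arc_lengthB// xs yt.
have Vb : arc_length gamma' (rpath_end gamma') = t - s.
  by have := Lg'; rewrite rpath_lengthE => -[].
have clampE r : 0 <= r <= t - s ->
    arc_param_clamp gamma' r = arc_param_clamp gamma (s + r).
  move=> r0.
  have [z zxy <-] : exists2 z, rpath_start gamma' <= z <= rpath_end gamma' &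
      arc_length gamma' z = r.
    by apply: arc_length_surj; rewrite Vb.
  rewrite arc_param_clampV//; have /andP[/= xz zy] := zxy.
  rewrite /arc_length/= arc_lengthB ?(le_trans zy)//= -xs addrC subrK.
  by rewrite arc_param_clampV// (le_trans ax xz) (le_trans zy).
split => //.
- by rewrite -xs arc_param_clampV.
- by rewrite -yt arc_param_clampV.
move=> g bg g0; rewrite line_integralE Lg'.
transitivity (\int[lebesgue]_(r in `[0%R, (t - s)%R])
    (g \o arc_param_clamp gamma) (s + r)%R)%E.
  by apply: eq_integral => r /set_mem r0; rewrite clampE//; move: r0; rewrite /= in_itv.
rewrite (ge0_integral_shift _ _ _ (measurable_fun_arc gamma bg) (fun=> g0 _)).
by rewrite addr0 addrC subrK.
Qed.

End LineIntegral.

(** * Integral bounds on an interval *)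

Section AbsoluteContinuity.
Context d (T : measurableType d) (R : realType) (mu : {measure set T -> \bar R}).
Local Open Scope ereal_scope.

Lemma integral_absolutely_continuous (f : T -> \bar R) (e : R) :
  measurable_fun [set: T] f -> (forall x, 0 <= f x) ->
  \int[mu]_x f x < +oo -> (0 < e)%R ->
  exists2 del : R, (0 < del)%R & forall A, measurable A -> mu A < del%:E ->
    \int[mu]_(x in A) f x <= e%:E.
Proof.
move=> mf f0 intf e0.
have If : mu.-integrable [set: T] f.
  apply/integrableP; split => //.
  by under eq_integral do rewrite gee0_abs//.
have fin : {ae mu, forall x, [set: T] x -> f x \is a fin_num}.
  exact: integrable_ae.
have mff : measurable_fun [set: T] (EFin \o (fine \o f)).
  by apply/measurable_EFinP; apply: measurableT_comp.
have aeq A : measurable A -> \int[mu]_(x in A) f x =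
    \int[mu]_(x in A) (`|fine (f x)|%R)%:E.
  move=> mA; apply: ge0_ae_eq_integral => //.
  - exact: measurable_funTS.
  - apply: measurable_funTS; apply/measurable_EFinP.
    by apply: measurableT_comp => //; apply: measurableT_comp.
  - apply: filterS fin => x /= fx Ax; rewrite ger0_norm ?fine_ge0//.
    by rewrite fineK// fx.
have Iff : mu.-integrable [set: T] (EFin \o (fine \o f)).
  apply/integrableP; split => //.
  by rewrite (_ : integral _ _ _ = \int[mu]_x f x)// aeq.
have [del [d0 H]] := integral_normr_continuous Iff e0.
exists del => // A mA Ad; have := H A mA Ad.
rewrite aeq// /Rintegral -lte_fin fineK; first exact: ltW.
rewrite -aeq// ge0_fin_numE ?integral_ge0//.
apply: le_lt_trans intf; apply: ge0_subset_integral => //.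
Qed.

End AbsoluteContinuity.

Section MinOfBounds.
Context {R : realType}.
Local Open Scope ereal_scope.
Local Notation lebesgue := (@lebesgue_measure R).
Implicit Types (h : R -> R) (k : R -> \bar R) (a b : R).

Lemma ge0_integral_itv_split k a c b : measurable_fun [set: R] k ->
  (forall x, 0 <= k x) -> (a <= c)%R -> (c <= b)%R ->
  \int[lebesgue]_(x in `[a, b]) k x =
    \int[lebesgue]_(x in `[a, c]) k x + \int[lebesgue]_(x in `[c, b]) k x.
Proof.
move=> mk k0 ac cb.
rewrite -(@integral_itv_obnd_cbnd _ c); last exact: measurable_funTS.
rewrite -ge0_integral_setU//.
- by rewrite -itv_bndbnd_setU// bnd_simp.
- exact: measurable_funTS.
- apply/disj_setPS => x [] /=; rewrite !in_itv/= => /andP[_ xc] /andP[cx _].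
  by move: (lt_le_trans cx xc); rewrite ltxx.
Qed.

(** Bounds on short intervals add up by the triangle inequality. The induction removes a last piece
    of length at most [eta / 2], half of [eta] because the hypothesis asks for a strictly smaller
    length. *)
Lemma integral_bound_local_to_global h k a b (eta : R) : (0 < eta)%R ->
  measurable_fun [set: R] k -> (forall x, 0 <= k x) ->
  (forall s t, (a <= s)%R -> (s <= t)%R -> (t <= b)%R -> (t - s < eta)%R ->
    `|h s - h t|%:E <= \int[lebesgue]_(x in `[s, t]) k x) ->
  (a <= b)%R -> `|h a - h b|%:E <= \int[lebesgue]_(x in `[a, b]) k x.
Proof.
move=> eta0 mk k0 H ab.
have e20 : (0 < eta / 2)%R by rewrite divr_gt0.
have [n] : exists n : nat, (b - a <= n%:R * (eta / 2))%R.
  have : (0 <= (b - a) / (eta / 2))%R by rewrite divr_ge0 ?subr_ge0// ltW.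
  move=> /archi_boundP/ltW; set n := Num.Def.archi_bound _ => nP.
  by exists n; rewrite -ler_pdivrMr.
elim: n b H ab => [|n IH] b H ab.
  rewrite mul0r subr_le0 => ba; have -> : b = a by apply/eqP; rewrite eq_le ba.
  by rewrite subrr normr0 integral_ge0.
move=> nP; pose c := Num.max a (b - eta / 2)%R.
have ac : (a <= c)%R by rewrite le_max lexx.
have cb : (c <= b)%R by rewrite ge_max ab gerBl ltW.
have ca : (c - a <= n%:R * (eta / 2))%R.
  have : (0 <= n%:R * (eta / 2))%R by rewrite mulr_ge0// ltW.
  move: nP; rewrite -natr1 mulrDl mul1r; set m := (_ * _)%R => nP m0.
  rewrite lerBlDr ge_max; apply/andP; split; lra.
have bc : (b - c < eta)%R.
  have : (b - eta / 2 <= c)%R by rewrite le_max lexx orbT.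
  lra.
rewrite (ge0_integral_itv_split mk k0 ac cb).
apply: (@le_trans _ _ (`|h a - h c| + `|h c - h b|)%:E).
  by rewrite lee_fin ler_distD.
rewrite EFinD leeD//.
  by apply: IH => // s t as_ st tc ts; apply: H => //; exact: le_trans cb.
exact: H.
Qed.

Lemma compact_closed_disjoint_distance (K F : set R) : compact K -> closed F ->
  K `&` F = set0 ->
  exists2 eta : R, (0 < eta)%R & forall x y, K x -> F y -> (eta <= `|x - y|)%R.
Proof.
move=> cK cF KF.
have := (compact_near_coveringP K).1 cK R (0%R^'+)
  (fun eta x => forall y, F y -> (eta <= `|x - y|)%R) _.
case.
  move=> x Kx.
  have oF : open (~` F) by exact: closed_openC.
  have nFx : nbhs x (~` F).
    by apply: open_nbhs_nbhs; split => // Fx; have : (K `&` F) x by []; rewrite KF.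
  have [r r0 rF] := nFx.
  exists (ball x (r / 2)%R, [set e : R | (0 < e < r / 2)%R]) => /=.
    split; first by apply: nbhsx_ballx; rewrite divr_gt0.
    near=> e; apply/andP; split => //.
    by near: e; apply: nbhs_right_lt; rewrite divr_gt0.
  move=> [x' e] /= [xx' /andP[e0 er]] y Fy.
  rewrite leNgt; apply/negP => x'y; apply: (rF y) => //=.
  rewrite -(@subrK _ x' x) -addrA; apply: le_lt_trans (ler_normD _ _) _.
  move: xx'; rewrite /ball/= => xx'; lra.
move=> r/= r0 H; exists (r / 2)%R; first by rewrite divr_gt0.
move=> x y Kx Fy; apply: (H (r / 2)%R) => //=; last by rewrite divr_gt0.
rewrite sub0r normrN gtr0_norm ?divr_gt0// ltr_pdivrMr//.
by rewrite ltr_pMr// ltr1n.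
Unshelve. all: by end_near. Qed.

(* With [K] and [K'] disjoint compact sets filling most of [k1 <= k2] and of its
   complement, an interval shorter than their distance misses one of them, so
   on it one of the two bounds is at most [mine k1 k2] up to what happens off
   [K `|` K']. *)
Lemma integral_bound_mine h k1 k2 a b :
  measurable_fun [set: R] k1 -> (forall x, 0 <= k1 x) ->
  measurable_fun [set: R] k2 -> (forall x, 0 <= k2 x) ->
  \int[lebesgue]_(x in `[a, b]) k1 x < +oo ->
  \int[lebesgue]_(x in `[a, b]) k2 x < +oo ->
  (forall s t, (a <= s)%R -> (s <= t)%R -> (t <= b)%R ->
    `|h s - h t|%:E <= \int[lebesgue]_(x in `[s, t]) k1 x /\
    `|h s - h t|%:E <= \int[lebesgue]_(x in `[s, t]) k2 x) ->
  (a <= b)%R ->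
  `|h a - h b|%:E <= \int[lebesgue]_(x in `[a, b]) mine (k1 x) (k2 x).
Proof.
move=> mk1 k10 mk2 k20 fk1 fk2 H ab.
apply/lee_addgt0Pr => e e0.
pose I : set R := `[a, b]%classic.
have mI : measurable I by exact: measurable_itv.
pose f : R -> \bar R := (fun x => k1 x + k2 x) \_ I.
have mk12 : measurable_fun [set: R] (fun x => k1 x + k2 x).
  exact: emeasurable_funD.
have f0 x : 0 <= f x.
  by rewrite /f patchE; case: ifP => // _; rewrite adde_ge0.
have mf : measurable_fun [set: R] f.
  by apply/(measurable_restrictT _ _).1 => //; exact: measurable_funTS.
have intf : \int[lebesgue]_x f x < +oo.
  rewrite -integral_mkcond ge0_integralD//; last 2 first.
  - exact: measurable_funTS.
  - exact: measurable_funTS.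
  exact: lte_add_pinfty.
have [del del0 Hdel] := @integral_absolutely_continuous _ (measurableTypeR R) R lebesgue f e mf f0 intf e0.
have d20 : (0 < del / 2)%R by rewrite divr_gt0.
pose E := I `&` [set x | k1 x <= k2 x].
have mE : measurable E by apply: measurable_lee => //; exact: measurable_funTS.
have Ifin A : measurable A -> A `<=` I -> lebesgue A < +oo.
  move=> mA AI; apply: (@le_lt_trans _ _ (lebesgue I)).
    by apply: le_measure => //; rewrite inE.
  by rewrite /I lebesgue_measure_itv/=; case: ifP; rewrite ?ltry.
have mE' : measurable (I `\` E) by exact: measurableD.
have [K [cK KE lK]] := lebesgue_regularity_inner mE (Ifin _ mE (@subIsetl _ _ _)) d20.
have [K' [cK' KE' lK']] := lebesgue_regularity_inner mE' (Ifin _ mE' (@subDsetl _ _ _)) d20.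
have clK : closed K by apply: compact_closed => //; exact: Rhausdorff.
have clK' : closed K' by apply: compact_closed => //; exact: Rhausdorff.
have mK : measurable K by exact: closed_measurable.
have mK' : measurable K' by exact: closed_measurable.
have KK' : K `&` K' = set0.
  by apply/seteqP; split => // x [/KE Ex /KE'[_ nEx]].
have [eta eta0 Heta] := compact_closed_disjoint_distance cK clK' KK'.
pose N := I `\` (K `|` K').
have mN : measurable N by apply: measurableD => //; exact: measurableU.
have lN : lebesgue N < del%:E.
  apply: (@le_lt_trans _ _ (lebesgue ((E `\` K) `|` ((I `\` E) `\` K')))).
    apply: le_measure; rewrite ?inE//.
      by apply: measurableU; apply: measurableD.
    move=> x [Ix nKx]; have [Ex|nEx] := pselect (E x).
      by left; split => // Kx; apply: nKx; left.
    by right; split => // K'x; apply: nKx; right.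
  apply: le_lt_trans (measureU2 _ _ _) _; try exact: measurableD.
  by rewrite [del]splitr EFinD; exact: lteD.
(* [m] is the minimum, corrected on the small set [N] so as to dominate both bounds there; the
   correction integrates to at most [e] by the choice of [del]. *)
pose m x := mine (k1 x) (k2 x) + (f \_ N) x.
have mn0 x : 0 <= mine (k1 x) (k2 x) by rewrite le_min k10 k20.
have fN0 x : 0 <= (f \_ N) x by rewrite patchE; case: ifP.
have mmin : measurable_fun [set: R] (fun x => mine (k1 x) (k2 x)).
  exact: measurable_mine.
have mfN : measurable_fun [set: R] (f \_ N).
  by apply/(measurable_restrictT _ _).1 => //; exact: measurable_funTS.
have m0 x : 0 <= m x by rewrite adde_ge0.
have mm : measurable_fun [set: R] m by exact: emeasurable_funD.
have fI x : I x -> f x = k1 x + k2 x by move=> Ix; rewrite /f patchE mem_set.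
have mN1 x : I x -> ~ K x -> ~ K' x -> k1 x <= m x /\ k2 x <= m x.
  move=> Ix nK nK'; rewrite /m patchE mem_set; last by split => // -[].
  rewrite fI//; split.
    by rewrite (le_trans _ (leeDr _ _))// leeDl.
  by rewrite (le_trans _ (leeDr _ _))// leeDr.
have key : `|h a - h b|%:E <= \int[lebesgue]_(x in `[a, b]) m x.
  apply: (integral_bound_local_to_global eta0) => // s t as_ st tb ts.
  have [H1 H2] := H s t as_ st tb.
  have stI x : `[s, t]%classic x -> I x.
    by rewrite /I /= !in_itv/= => /andP[sx xt]; rewrite (le_trans as_ sx) (le_trans xt tb).
  have [[x sx Kx]|nK] := pselect (exists2 x, `[s, t]%classic x & K x).
    apply: le_trans H1 _; apply: ge0_le_integral => //; try exact: measurable_funTS.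
    move=> y sty.
    have nK'y : ~ K' y.
      move=> K'y; have := Heta x y Kx K'y; rewrite leNgt => /negP; apply.
      apply: le_lt_trans ts; move: sx sty; rewrite /= !in_itv/=.
      by move=> /andP[? ?] /andP[? ?]; rewrite ler_norml; apply/andP; split; lra.
    have [Ky|nKy] := pselect (K y); last by apply: (mN1 _ _ _ _).1 => //; exact: stI.
    have [_ /= k12] := KE y Ky.
    by rewrite /m min_l// leeDl.
  apply: le_trans H2 _; apply: ge0_le_integral => //; try exact: measurable_funTS.
  move=> y sty.
  have nKy : ~ K y by move=> Ky; apply: nK; exists y.
  have [K'y|nK'y] := pselect (K' y); last by apply: (mN1 _ _ _ _).2 => //; exact: stI.
  have [Iy nEy] := KE' y K'y.
  have k21 : k2 y <= k1 y.
    by rewrite leNgt; apply/negP => /ltW k12; apply: nEy.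
  by rewrite /m min_r// leeDl.
apply: le_trans key _; rewrite ge0_integralD//; try exact: measurable_funTS.
rewrite leeD2l//.
rewrite -integral_mkcondr setIidr; last by move=> x [].
exact: Hdel.
Qed.

End MinOfBounds.

(** * Borel functions and modulus *)

Section BorelFunctions.
Context {R : realType} {X : pmetricType R}.
Local Open Scope ereal_scope.
Implicit Types (g f : X -> \bar R) (gamma : rpath X).
Local Notation borelT := (g_sigma_algebraType (@open X)).

Lemma borel_open (U : set X) : open U -> borel_set U.
Proof. by move=> oU; apply: sub_sigma_algebra. Qed.

Lemma borel_cst (c : \bar R) : borel_fun (fun _ : X => c).
Proof. exact: measurable_cst. Qed.

Lemma borel_funD f g : borel_fun f -> borel_fun g -> borel_fun (f \+ g).
Proof. by move=> mf mg; exact: (@emeasurable_funD _ borelT). Qed.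

Lemma borel_fun_mine f g : borel_fun f -> borel_fun g ->
  borel_fun (fun x => mine (f x) (g x)).
Proof. by move=> mf mg; exact: (@measurable_mine _ borelT). Qed.

Lemma borel_fun_scale (c : R) f : borel_fun f -> borel_fun (fun x => c%:E * f x).
Proof. by move=> mf; apply: (@emeasurable_funM _ borelT) => //; exact: borel_cst. Qed.

Lemma borel_fun_restrict f (U : set X) : borel_set U -> borel_fun f ->
  borel_fun (f \_ U).
Proof.
move=> bU bf.
have bfU : measurable_fun (U : set borelT) (f : borelT -> \bar R).
  by apply: measurable_funS bf.
exact: (@measurable_restrictT _ _ borelT _ (U : set borelT) f bU).1 bfU.
Qed.

Lemma borel_fun_nneseries (f : nat -> X -> \bar R) :
  (forall n, borel_fun (f n)) -> (forall n x, 0 <= f n x) ->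
  borel_fun (fun x => \sum_(n <oo) f n x).
Proof.
move=> bf f0; have := @ge0_emeasurable_sum _ borelT R setT f xpredT.
by apply => // k _; exact: bf.
Qed.

Lemma borel_fun_sum (I : Type) (s : seq I) (f : I -> X -> \bar R) :
  (forall i, borel_fun (f i)) -> borel_fun (fun x => \sum_(i <- s) f i x).
Proof. by move=> bf; exact: (@emeasurable_sum _ borelT). Qed.

Lemma line_integral_ge0 gamma f : (forall x, 0 <= f x) ->
  0 <= line_integral gamma f.
Proof. by move=> f0; apply: integral_ge0. Qed.

Lemma line_integral_le gamma f g : borel_fun f -> borel_fun g ->
  (forall x, 0 <= f x) -> (forall x, f x <= g x) ->
  line_integral gamma f <= line_integral gamma g.
Proof.
move=> bf bg f0 fg; rewrite !line_integralE; apply: ge0_le_integral => //.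
- exact: measurable_funTS (measurable_fun_arc gamma bf).
- exact: measurable_funTS (measurable_fun_arc gamma bg).
Qed.

Lemma line_integralZ gamma (c : R) f : borel_fun f -> (forall x, 0 <= f x) ->
  (0 <= c)%R ->
  line_integral gamma (fun x => c%:E * f x) = c%:E * line_integral gamma f.
Proof.
move=> bf f0 c0; rewrite !line_integralE ge0_integralZl//.
exact: measurable_funTS (measurable_fun_arc gamma bf).
Qed.

Lemma line_integral_nneseries gamma (f : nat -> X -> \bar R) :
  (forall n, borel_fun (f n)) -> (forall n x, 0 <= f n x) ->
  line_integral gamma (fun x => \sum_(n <oo) f n x) =
  \sum_(n <oo) line_integral gamma (f n).
Proof.
move=> bf f0; rewrite line_integralE integral_nneseries//; last first.
  by move=> n; exact: measurable_funTS (measurable_fun_arc gamma (bf n)).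
by apply: eq_eseriesr => n _; rewrite line_integralE.
Qed.

End BorelFunctions.

Section Modulus.
Context {R : realType} {X : pmetricType R}.
Variable mu : {outer_measure set X -> \bar R}.
Hypothesis bmu : borel_regular mu.
Local Open Scope ereal_scope.
Implicit Types (g f rho : X -> \bar R) (gamma : rpath X).
Local Notation borelT := (g_sigma_algebraType (@open X)).
Local Notation caraT := (caratheodory_type mu).
Local Notation "'Int' f" := (\int[cara_measure mu]_x f x) (at level 10, f at level 9).

Lemma borel_cara (B : set X) : borel_set B -> measurable (B : set caraT).
Proof. by move=> bB; exact: bmu.1. Qed.

Lemma borel_fun_cara g (D : set caraT) : borel_fun g ->
  measurable_fun D (g : caraT -> \bar R).
Proof.
move=> bg; apply: measurable_funTS => _ Y mY; rewrite setTI.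
apply: borel_cara; have := bg measurableT Y mY; by rewrite setTI.
Qed.

Lemma integral_cara_le f g : borel_fun f -> borel_fun g ->
  (forall x, 0 <= f x) -> (forall x, f x <= g x) -> Int f <= Int g.
Proof.
by move=> bf bg f0 fg; apply: ge0_le_integral => //; exact: borel_fun_cara.
Qed.

Lemma integral_caraD f g : borel_fun f -> borel_fun g ->
  (forall x, 0 <= f x) -> (forall x, 0 <= g x) ->
  Int (f \+ g) = Int f + Int g.
Proof.
by move=> bf bg f0 g0; apply: ge0_integralD => //; exact: borel_fun_cara.
Qed.

Lemma integral_caraZ (c : R) f : borel_fun f -> (forall x, 0 <= f x) ->
  (0 <= c)%R -> Int (fun x => c%:E * f x) = c%:E * Int f.
Proof.
by move=> bf f0 c0; apply: ge0_integralZl => //; exact: borel_fun_cara.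
Qed.

Lemma integral_cara_nneseries (f : nat -> X -> \bar R) :
  (forall n, borel_fun (f n)) -> (forall n x, 0 <= f n x) ->
  Int (fun x => \sum_(n <oo) f n x) = \sum_(n <oo) Int (f n).
Proof.
by move=> bf f0; apply: integral_nneseries => // n; exact: borel_fun_cara.
Qed.

(* A density witnessing that a family of paths is exceptional: almost every path
   has a finite line integral against it. *)
Definition density rho :=
  [/\ borel_fun rho, forall x, 0 <= rho x & Int rho < +oo].

Lemma densityD f g : density f -> density g -> density (f \+ g).
Proof.
move=> [bf f0 fi] [bg g0 gi]; split; first exact: borel_funD.
  by move=> x; rewrite adde_ge0.
by rewrite integral_caraD// lte_add_pinfty.
Qed.

(** Countably many exceptional families are avoided at once. The weights [c n] make the integrals of
    the terms at most [2 ^ -(n + 1)], and being positive they let finiteness pass from the sum to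
    each term; adding 1 in the denominator covers a zero integral. *)
Lemma density_series (f : nat -> X -> \bar R) : (forall n, density (f n)) ->
  exists rho, density rho /\ forall gamma, line_integral gamma rho < +oo ->
    forall n, line_integral gamma (f n) < +oo.
Proof.
move=> df; pose c n : R := ((2 ^ n.+1)%:R^-1 / (1 + fine (Int (f n))))%R.
have bf n : borel_fun (f n) by case: (df n).
have f0 n x : 0 <= f n x by case: (df n).
have fi n : Int (f n) < +oo by case: (df n).
have I0 n : (0 < 1 + fine (Int (f n)))%R.
  by rewrite ltr_pwDl// fine_ge0// integral_ge0.
have c0 n : (0 < c n)%R by rewrite divr_gt0// invr_gt0 ltr0n expn_gt0.
pose F n x := (c n)%:E * f n x.
have bF n : borel_fun (F n) by exact: borel_fun_scale.
have F0 n x : 0 <= F n x by rewrite mule_ge0// lee_fin ltW.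
exists (fun x => \sum_(n <oo) F n x); split.
  split; first exact: borel_fun_nneseries.
    by move=> x; exact: nneseries_ge0.
  rewrite integral_cara_nneseries//; apply: (@le_lt_trans _ _ 1%:E); last exact: ltry.
  apply: le_trans (@epsilon_trick0 R 1 xpredT ler01); apply: lee_nneseries => n _.
    by rewrite integral_ge0.
  rewrite integral_caraZ// ?(ltW (c0 n))// -[Int (f n)]fineK; last first.
    by rewrite ge0_fin_numE// integral_ge0.
  rewrite -EFinM lee_fin /c div1r -mulrA ler_piMr ?invr_ge0 ?ler0n//.
  by rewrite mulrC ler_pdivrMr// mul1r lerDr.
move=> gamma fin n; rewrite -(@lte_pmul2l _ (c n)%:E)//; last by rewrite lte_fin.
rewrite gt0_muley ?lte_fin//; apply: le_lt_trans fin.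
rewrite -line_integralZ// ?(ltW (c0 n))// -/(F n).
by apply: line_integral_le => //; [exact: borel_fun_nneseries|move=> x;
  rewrite (@nneseriesD1 _ _ n xpredT)// leeDl// nneseries_ge0].
Qed.

(** Fuglede's characterization. An infinite line integral stays infinite under small multiples, so
    such a family has modulus 0; conversely, admissible densities of integral at most [2 ^ -(n + 1)]
    are summed, each adding at least 1 along every path of the family. *)
Lemma modulus1_eq0P (Gamma : set (rpath X)) : modulus1 mu Gamma = 0 <->
  exists2 rho, density rho &
    forall gamma, Gamma gamma -> line_integral gamma rho = +oo.
Proof.
split=> [mod0|[rho [brho rho0 rhofin] Hrho]]; last first.
  apply/eqP; rewrite eq_le; apply/andP; split; last first.
    by apply: le_ereal_inf_tmp => _ [f [bf f0 _] <-]; exact: integral_ge0.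
  apply/lee_addgt0Pr => e e0; rewrite add0e.
  pose I := fine (Int rho).
  have I0 : (0 <= I)%R by rewrite fine_ge0// integral_ge0.
  have II : Int rho = I%:E by rewrite fineK// ge0_fin_numE// integral_ge0.
  pose c := (e / (1 + I))%R.
  have c0 : (0 < c)%R by rewrite divr_gt0// ltr_pwDl.
  apply: (@le_trans _ _ (Int (fun x => c%:E * rho x))).
    apply: ereal_inf_lbound => /=; exists (fun x => c%:E * rho x) => //; split.
    - exact: borel_fun_scale.
    - by move=> x; rewrite mule_ge0// lee_fin ltW.
    - move=> gamma /Hrho Hg; rewrite line_integralZ// ?(ltW c0)// Hg.
      by rewrite gt0_muley ?lte_fin// leey.
  rewrite integral_caraZ// ?(ltW c0)// II -EFinM lee_fin /c -mulrA ler_piMr ?(ltW e0)//.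
  by rewrite mulrC ler_pdivrMr ?ltr_pwDl// mul1r lerDr.
have H n : exists rho, [/\ borel_fun rho, forall x, 0 <= rho x,
    Int rho <= ((2 ^ n.+1)%:R^-1)%:E &
    forall gamma, Gamma gamma -> 1 <= line_integral gamma rho].
  have e0 : (0 < (2 ^ n.+1)%:R^-1 :> R)%R by rewrite invr_gt0 ltr0n expn_gt0.
  have fn : modulus1 mu Gamma \is a fin_num by rewrite mod0.
  have [_ [rho [brho rho0 Hrho] <-]] := lb_ereal_inf_adherent e0 fn.
  rewrite -/(modulus1 mu Gamma) mod0 add0e => /ltW lt.
  by exists rho.
have [rho Hrho] := choice H.
exists (fun x => \sum_(n <oo) rho n x).
  split.
  - by apply: borel_fun_nneseries => [n|n x]; case: (Hrho n).
  - by move=> x; apply: nneseries_ge0 => n _ _; case: (Hrho n).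
  - rewrite integral_cara_nneseries; last 2 first.
    + by move=> n; case: (Hrho n).
    + by move=> n x; case: (Hrho n).
    apply: (@le_lt_trans _ _ 1%:E); last exact: ltry.
    apply: le_trans (@epsilon_trick0 R 1 xpredT ler01); apply: lee_nneseries => n _.
      by move=> _; apply: integral_ge0 => x _; case: (Hrho n).
    by rewrite div1r; case: (Hrho n).
move=> gamma Gg; rewrite line_integral_nneseries; last 2 first.
  + by move=> n; case: (Hrho n).
  + by move=> n x; case: (Hrho n).
apply/eqyP => A A0.
have [n nA] : exists n : nat, (A <= n%:R)%R.
  by have := archi_boundP (ltW A0) => /ltW H'; eexists; exact: H'.
apply: (@le_trans _ _ (\sum_(0 <= i < n) line_integral gamma (rho i))); last first.
  apply: nneseries_lim_ge => i _ _; apply: line_integral_ge0 => x.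
  by case: (Hrho i).
apply: (@le_trans _ _ (\sum_(0 <= i < n) 1)).
  by rewrite sumEFin lee_fin big_const_nat subn0 iter_addr_0.
by apply: lee_sum => i _; case: (Hrho i) => _ _ _; exact.
Qed.

(** The exceptional paths become those of infinite integral against a density: finiteness of that
    integral passes to subpaths, and finitely many conditions combine by adding densities. *)
Lemma weak_upper_gradientP (u g : X -> \bar R) :
  weak_upper_gradient mu u g <->
  [/\ borel_fun g, forall x, 0 <= g x & exists2 rho, density rho &
    forall gamma, 0 < rpath_length gamma -> line_integral gamma rho < +oo ->
      upper_gradient_along u g gamma].
Proof.
split=> -[bg g0].
  move=> [Gamma /modulus1_eq0P[rho drho Hrho] H]; split => //; exists rho => //.
  move=> gamma g1 fin; apply: H => // /Hrho E.
  by move: fin; rewrite E ltxx.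
move=> [rho drho Hrho]; split => //.
exists [set gamma | line_integral gamma rho = +oo].
  by apply/modulus1_eq0P; exists rho.
move=> gamma gl /= ng; apply: Hrho => //.
by rewrite ltey; apply/eqP.
Qed.

End Modulus.

(** * Finite nets in uniform spaces *)

Section Nets.
Context {R : realType} {X : pmetricType R}.
Implicit Types (N : seq X) (x y z : X) (s D : R).

Definition separated_seq s N :=
  uniq N /\ {in N &, forall y z, y != z -> s <= mdist y z}.

Lemma separated_filter s N (p : pred X) : separated_seq s N -> separated_seq s [seq x <- N | p x].
Proof.
move=> [uN sN]; split; first exact: filter_uniq.
by move=> y z; rewrite !mem_filter => /andP[_ yN] /andP[_ zN]; exact: sN.
Qed.

Lemma open_metric_ball x (r : R) : open (ball x r).
Proof.
rewrite openE => y; rewrite ballEmdist/= => xy; rewrite /interior.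
apply/nbhs_ballP; exists (r - mdist x y) => /=; first by rewrite subr_gt0.
move=> z; rewrite !ballEmdist/= => yz.
by apply: le_lt_trans (metric_triangle x y z) _; rewrite addrC -ltrBrDr.
Qed.

Variable mu : {outer_measure set X -> \bar R}.
Hypothesis mmu : metric_measure_space mu.
Hypothesis umu : uniform_mms mu.

Lemma measurable_metric_ball x (r : R) :
  measurable (ball x r : set (caratheodory_type mu)).
Proof.
by case: mmu => bmu _ _; apply: borel_cara bmu _ _; apply: borel_open;
  exact: open_metric_ball.
Qed.

(** Balls of radius [s / 2] about [s]-separated points are disjoint, so their measures add up inside
    [A]. *)
Lemma separated_measure (c s : R) N (A : set (caratheodory_type mu)) :
  measurable A -> separated_seq s N -> (forall y, c%:E <= mu (ball y (s / 2)))%E ->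
  {in N, forall y, ball y (s / 2) `<=` A} ->
  ((c * (size N)%:R)%:E <= mu A)%E.
Proof.
move=> + + Hc; elim: N A => [|y N IH] A mA [/= uN sN] NA.
  by rewrite mulr0; exact: measure_ge0 (cara_measure mu) A.
have /andP[yN uN'] := uN.
pose B : set (caratheodory_type mu) := ball y (s / 2).
have mB : measurable B by exact: measurable_metric_ball.
have -> : mu A = ((cara_measure mu) (A `\` B) + (cara_measure mu) (A `&` B))%E.
  exact: (measureDI (cara_measure mu)).
rewrite -natr1 mulrDr mulr1 EFinD leeD//.
  apply: IH; first exact: measurableD.
    split=> // u v uN0 vN0; apply: sN; rewrite in_cons ?uN0 ?vN0 orbT//.
  move=> z zN w zw; split; first by apply: (NA z) => //; rewrite in_cons zN orbT.
  move: zw; rewrite /B !ballEmdist/= => zw yw.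
  have : s <= mdist y z.
    apply: sN; rewrite ?in_cons ?eqxx ?zN ?orbT//.
    by apply: contraNneq yN => ->.
  apply/negP; rewrite -ltNge; apply: le_lt_trans (metric_triangle y w z) _.
  rewrite (metric_sym w); lra.
rewrite setIidr; last by apply: NA; rewrite in_cons eqxx.
exact: Hc.
Qed.

(** The disjoint balls of radius [s / 2] all lie in the ball of radius [D + s] about [x]; the
    uniform volume bounds [f] and [g] make the resulting count independent of [x]. *)
Lemma separated_multiplicity s D : 0 < s -> 0 < D -> exists M : nat,
  forall N x, separated_seq s N -> {in N, forall y, mdist x y < D} -> (size N <= M)%N.
Proof.
move=> s0 D0; case: umu => f [g [fg0 _ fg]].
have s20 : 0 < s / 2 by rewrite divr_gt0.
have f0 : 0 < f (s / 2) by case: (fg0 _ s20).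
have Ds : 0 < D + s by rewrite addr_gt0.
have : 0 <= g (D + s) / f (s / 2) by rewrite divr_ge0// ltW//; case: (fg0 _ Ds).
move=> /archi_boundP; set M := Num.Def.archi_bound _ => HM.
exists M => N x sN Nx; rewrite -(ler_nat R); apply: le_trans (ltW HM).
rewrite ler_pdivlMr// mulrC -lee_fin.
have [_ gx] := fg x _ Ds; apply: le_trans gx.
apply: (@separated_measure _ s) => //.
- exact: measurable_metric_ball.
- by move=> y; case: (fg y _ s20).
- move=> y yN z; rewrite !ballEmdist/= => yz.
  apply: le_lt_trans (metric_triangle x y z) _.
  have := Nx y yN; lra.
Qed.

Lemma separated_count s D : 0 < s -> 0 < D -> exists M : nat,
  forall N x, separated_seq s N -> (size [seq y <- N | (mdist x y < D)%R] <= M)%N.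
Proof.
move=> s0 D0; have [M HM] := separated_multiplicity s0 D0.
exists M => N x sN; apply: (HM _ x); first exact: separated_filter.
by move=> y; rewrite mem_filter => /andP[].
Qed.

(** A separated family of maximal cardinality is a net, since an uncovered point could be added to
    it; the multiplicity bound makes the cardinalities bounded. *)
Lemma finite_net s D x : 0 < s -> 0 < D -> exists N, [/\ separated_seq s N,
  {in N, forall y, mdist x y < D} &
  forall y, mdist x y < D -> exists2 z, z \in N & mdist y z < s].
Proof.
move=> s0 D0; have [M HM] := separated_multiplicity s0 D0.
pose P n := `[< exists N, [/\ separated_seq s N, {in N, forall y, mdist x y < D} &
  size N = n] >].
have Pex : exists n, P n by exists 0%N; apply/asboolP; exists [::].
have Pub n : P n -> (n <= M)%N.
  by move=> /asboolP[N [sN Nx <-]]; exact: HM Nx.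
case: (ex_maxnP Pex Pub) => n /asboolP[N [sN Nx Nn]] nmax.
exists N; split => // y xy; apply: contrapT => H.
have /nmax : P n.+1.
  apply/asboolP; exists (y :: N); split => /=; last by rewrite Nn.
    have far z : z \in N -> s <= mdist y z.
      by move=> zN; rewrite leNgt; apply/negP => yz; apply: H; exists z.
    split=> /=.
      rewrite sN.1 andbT; apply/negP => yN.
      by move: (far y yN); rewrite mdistxx leNgt s0.
    move=> u v; rewrite !in_cons => /orP[/eqP->|uN] /orP[/eqP->|vN].
    - by rewrite eqxx.
    - by move=> _; exact: far.
    - by move=> _; rewrite metric_sym; exact: far.
    - exact: sN.2.
  by move=> z; rewrite in_cons => /orP[/eqP->//|]; exact: Nx.
by rewrite ltnn.
Qed.

Lemma inv_nat_small (e : R) : 0 < e -> exists k : nat, k.+1%:R^-1 < e.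
Proof.
move=> e0; have : 0 <= e^-1 by rewrite invr_ge0 ltW.
move=> /archi_boundP; set k := Num.Def.archi_bound _ => kP.
exists k; rewrite -[e]invrK ltf_pV2 ?posrE ?invr_gt0//.
by rewrite (lt_trans kP)// ltr_nat.
Qed.

(** The nets of mesh [1 / (k + 1)] in the balls of radius [m + 1] about [point] are all finite;
    their union is enumerated by pickling triples. *)
Lemma dense_sequence : exists d : nat -> X,
  forall x (e : R), 0 < e -> exists n, mdist x (d n) < e.
Proof.
have k0 k : 0 < k.+1%:R :> R by [].
have H (mk : nat * nat) : exists N : seq X,
    forall y, mdist point y < mk.1.+1%:R -> exists2 z, z \in N & mdist y z < mk.2.+1%:R^-1.
  have [|N [_ _ HN]] := @finite_net mk.2.+1%:R^-1 mk.1.+1%:R point _ (k0 _).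
    by rewrite invr_gt0.
  by exists N.
have [N HN] := choice H.
exists (fun n => if @unpickle (nat * nat * nat)%type n is Some (mk, j)
  then nth point (N mk) j else point).
move=> x e e0.
have [m xm] : exists m : nat, mdist point x < m.+1%:R.
  have := archi_boundP (mdist_ge0 (point : X) x); set m := Num.Def.archi_bound _ => mP.
  by exists m; rewrite (lt_trans mP)// ltr_nat.
have [k ke] := inv_nat_small e0.
have [z zN xz] := HN (m, k) x xm.
exists (pickle ((m, k), index z (N (m, k)))); rewrite pickleK nth_index//.
exact: lt_trans ke.
Qed.

Lemma loc_integrable_cover (g : X -> \bar R) : borel_fun g ->
  (forall x, 0 <= g x)%E -> loc_integrable mu g ->
  exists V : nat -> set X, [/\ forall n, open (V n), forall x, exists n, V n x &
    forall n, (\int[cara_measure mu]_(y in V n) g y < +oo)%E].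
Proof.
move=> bg g0 lg; have [d dd] := dense_sequence.
(* Lindelof argument: among the countably many balls with centre [d n] and radius [1 / (k + 1)],
   those of infinite integral are replaced by the empty set. Near [x], a radius below [r / 2] keeps
   the ball inside the good ball of [x]. *)
pose B (nk : nat * nat) := ball (d nk.1) nk.2.+1%:R^-1.
pose V n := if @unpickle (nat * nat)%type n is Some nk then
   (if (\int[cara_measure mu]_(y in B nk) g y < +oo)%E then B nk else set0) else set0.
exists V; split.
- move=> n; rewrite /V; case: unpickle => [nk|]; last exact: open0.
  by case: ifP => _; [exact: open_metric_ball|exact: open0].
- move=> x; have [r r0 xr] := lg x.
  have [k kr] : exists k : nat, k.+1%:R^-1 < r / 2 by apply: inv_nat_small; rewrite divr_gt0.
  have k0 : 0 < k.+1%:R^-1 :> R by rewrite invr_gt0.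
  have [n xn] := dd x _ k0; exists (pickle (n, k)); rewrite /V pickleK.
  rewrite ifT; first by rewrite /B ballEmdist/= metric_sym.
  apply: le_lt_trans xr; apply: ge0_subset_integral.
  - exact: measurable_metric_ball.
  - exact: measurable_metric_ball.
  - by case: mmu => bmu _ _; exact: borel_fun_cara.
  - by move=> y _; exact: g0.
  - move=> y; rewrite /B !ballEmdist/= => ny.
    apply: le_lt_trans (metric_triangle x (d n) y) _.
    by rewrite [r]splitr; apply: ltrD; exact: lt_trans kr.
- move=> n; rewrite /V; case: unpickle => [nk|]; last by rewrite integral_set0.
  by case: ifP => //; rewrite integral_set0.
Qed.

End Nets.

(** * Minimal weak upper gradients *)

Section MinimalWeakUpperGradient.
Context {R : realType} {X : pmetricType R}.
Variable mu : {outer_measure set X -> \bar R}.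
Hypothesis mmu : metric_measure_space mu.
Hypothesis umu : uniform_mms mu.
Local Open Scope ereal_scope.
Implicit Types (g f rho : X -> \bar R) (gamma : rpath X) (v : X -> R).
Local Notation "'Int' f" := (\int[cara_measure mu]_x f x) (at level 10, f at level 9).
Local Notation lebesgue := (@lebesgue_measure R).

Let bmu : borel_regular mu. Proof. by case: mmu. Qed.

(** A subpath of a path with finite integral against [rho] is again not exceptional, so the
    inequality holds on each of its subintervals, as [integral_bound_mine] requires. *)
Lemma upper_gradient_along_arc v g rho gamma :
  borel_fun g -> (forall x, 0 <= g x) -> borel_fun rho -> (forall x, 0 <= rho x) ->
  (forall gamma', 0 < rpath_length gamma' -> line_integral gamma' rho < +oo ->
     upper_gradient_along (EFin \o v) g gamma') ->
  line_integral gamma rho < +oo ->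
  forall s t, (0 <= s)%R -> (s <= t)%R -> (t <= fine (rpath_length gamma))%R ->
    `|v (arc_param_clamp gamma s) - v (arc_param_clamp gamma t)|%:E <=
    \int[lebesgue]_(r in `[s, t]) g (arc_param_clamp gamma r).
Proof.
move=> bg g0 brho rho0 H fin s t s0 st tL.
move: (st); rewrite le_eqVlt => /predU1P[->|st'].
  by rewrite subrr normr0; exact: integral_ge0.
have [gamma' [lg' <- <- Ig']] := subpath_exists s0 st tL.
rewrite -Ig'//; apply: H; first by rewrite lg' lte_fin subr_gt0.
rewrite Ig'//; apply: le_lt_trans fin; rewrite line_integralE.
apply: ge0_subset_integral => //.
- exact: measurable_funTS (measurable_fun_arc gamma brho).
- move=> r /=; rewrite !in_itv/= => /andP[sr rt].
  by rewrite (le_trans s0 sr) (le_trans rt tL).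
Qed.

Lemma line_integral_lty gamma f g : borel_fun f -> borel_fun g ->
  (forall x, 0 <= f x) -> (forall x, f x <= g x) ->
  line_integral gamma g < +oo -> line_integral gamma f < +oo.
Proof. by move=> bf bg f0 fg; apply: le_lt_trans; exact: line_integral_le. Qed.

(** [g] restricted to each open set of a countable cover is a density, and one density controls them
    all; by compactness a path meets only finitely many of these sets before being covered. *)
Lemma loc_integrable_line_integral g : borel_fun g -> (forall x, 0 <= g x) ->
  loc_integrable mu g -> exists2 rho, density mu rho &
    forall gamma, line_integral gamma rho < +oo -> line_integral gamma g < +oo.
Proof.
move=> bg g0 lg; have [V [oV cV fV]] := loc_integrable_cover mmu umu bg g0 lg.
have dV n : density mu (g \_ (V n)).
  split; first exact: borel_fun_restrict (borel_open (oV n)) bg.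
    by move=> x; rewrite patchE; case: ifP.
  by rewrite -integral_mkcond.
have [rho [drho Hrho]] := density_series bmu dV.
exists rho => // gamma fin.
pose eta := arc_param_clamp gamma; pose L := fine (rpath_length gamma).
have ceta : continuous eta by apply: lipschitz1_continuous; exact: arc_param_clamp_lip.
have [] := (compact_near_coveringP _).1 (@segment_compact R 0%R L) nat \oo
  (fun n s => exists2 i, (i < n)%N & V i (eta s)) _.
  move=> s _; have [i Vi] := cV (eta s).
  have nV : nbhs s (eta @^-1` V i).
    by apply: ceta; apply: open_nbhs_nbhs.
  exists (eta @^-1` V i, [set n | (i < n)%N]) => /=.
    by split => //; exists i.+1.
  by move=> [s' n] /= [Vs' lin]; exists i.
move=> n _ /(_ n (leqnn n)) Hn.
have le : line_integral gamma g <=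
    \int[lebesgue]_(s in `[0%R, L]) (\sum_(i <- iota 0 n) (g \_ (V i)) (eta s)).
  rewrite line_integralE; apply: ge0_le_integral => //.
  - exact: measurable_funTS (measurable_fun_arc gamma bg).
  - apply: emeasurable_sum => i; case: (dV i) => bV _ _.
    exact: measurable_funTS (measurable_fun_arc gamma bV).
  - move=> s /Hn[i lin Vs].
    rewrite (bigD1_seq i) ?mem_iota ?iota_uniq//= patchE mem_set//.
    by rewrite leeDl// sume_ge0// => j _; rewrite patchE; case: ifP.
apply: le_lt_trans le _; rewrite ge0_integral_sum//; last 2 first.
  - move=> i; case: (dV i) => bV _ _.
    exact: measurable_funTS (measurable_fun_arc gamma bV).
  - by move=> i s _; case: (dV i).
apply: lte_sum_pinfty => i _.
by have := Hrho gamma fin i; rewrite line_integralE.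
Qed.

Lemma weak_upper_gradient_mine v g1 g2 :
  weak_upper_gradient mu (EFin \o v) g1 -> Int g1 < +oo ->
  weak_upper_gradient mu (EFin \o v) g2 -> loc_integrable mu g2 ->
  weak_upper_gradient mu (EFin \o v) (fun x => mine (g1 x) (g2 x)).
Proof.
move=> /(weak_upper_gradientP bmu)[b1 g10 [rho1 d1 H1]] fin1.
move=> /(weak_upper_gradientP bmu)[b2 g20 [rho2 d2 H2]] l2.
have [rho3 d3 H3] := loc_integrable_line_integral b2 g20 l2.
apply/(weak_upper_gradientP bmu); split.
- exact: borel_fun_mine.
- by move=> x; rewrite le_min g10 g20.
have dg1 : density mu g1 by split.
(* [rho1] and [rho2] give the two inequalities along the path, [g1] and [rho3] the finiteness of the
   two line integrals. *)
pose rho := (rho1 \+ rho2) \+ (g1 \+ rho3).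
have drho : density mu rho by do ?apply: densityD.
have [br1 r10 _] := d1; have [br2 r20 _] := d2; have [br3 r30 _] := d3.
have [br r0 _] := drho.
exists rho => // gamma lg fin.
have L1 : line_integral gamma rho1 < +oo.
  apply: line_integral_lty fin => // x; rewrite /rho/=.
  by rewrite -addeA leeDl// !adde_ge0.
have L2 : line_integral gamma rho2 < +oo.
  apply: line_integral_lty fin => // x; rewrite /rho/=.
  by rewrite -addeA addeCA leeDl// !adde_ge0.
have L3 : line_integral gamma rho3 < +oo.
  apply: line_integral_lty fin => // x; rewrite /rho/=.
  by rewrite addeA leeDr// !adde_ge0.
have L4 : line_integral gamma g1 < +oo.
  apply: line_integral_lty fin => // x; rewrite /rho/=.
  by rewrite addeCA leeDl// !adde_ge0.
rewrite /upper_gradient_along -arc_param_clamp_start -arc_param_clamp_end/=.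
rewrite line_integralE.
apply: (@integral_bound_mine R (v \o arc_param_clamp gamma)
  (g1 \o arc_param_clamp gamma) (g2 \o arc_param_clamp gamma)) => //=.
- exact: measurable_fun_arc.
- exact: measurable_fun_arc.
- by rewrite -line_integralE.
- by rewrite -line_integralE; exact: H3.
- move=> s t s0 st tL; split.
    exact: (upper_gradient_along_arc b1 g10 br1 r10 H1).
  exact: (upper_gradient_along_arc b2 g20 br2 r20 H2).
- exact: fine_rpath_length_ge0.
Qed.

End MinimalWeakUpperGradient.

Section MinimalWeakUpperGradientExists.
Context {R : realType} {X : pmetricType R}.
Variable mu : {outer_measure set X -> \bar R}.
Hypothesis mmu : metric_measure_space mu.
Hypothesis umu : uniform_mms mu.
Local Open Scope ereal_scope.
Implicit Types (g f rho : X -> \bar R) (gamma : rpath X) (v : X -> R).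
Local Notation "'Int' f" := (\int[cara_measure mu]_x f x) (at level 10, f at level 9).
Local Notation lebesgue := (@lebesgue_measure R).
Local Notation borelT := (g_sigma_algebraType (@open X)).

Let bmu : borel_regular mu. Proof. by case: mmu. Qed.

Lemma borel_fun_inf_noninc (G : nat -> X -> \bar R) :
  (forall n, borel_fun (G n)) ->
  (forall x, {homo G^~ x : n m / (n <= m)%N >-> m <= n}) ->
  borel_fun (fun x => ereal_inf (range (G^~ x))).
Proof.
move=> bG Gn; apply: (@emeasurable_fun_cvg _ borelT _ _ G) => // x _.
exact: ereal_nonincreasing_cvgn.
Qed.

(** Along a path that is exceptional for no [G n] and has finite integral against [G 0], dominated
    convergence with dominating function [G 0] passes the inequality to the limit. *)
Lemma weak_upper_gradient_inf_noninc (u : X -> \bar R) (G : nat -> X -> \bar R) :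
  (forall n, weak_upper_gradient mu u (G n)) -> Int (G 0%N) < +oo ->
  (forall x, {homo G^~ x : n m / (n <= m)%N >-> m <= n}) ->
  weak_upper_gradient mu u (fun x => ereal_inf (range (G^~ x))).
Proof.
move=> wG fin Gn.
have /choice[rho Hrho] : forall n, exists rho, density mu rho /\
    forall gamma, 0 < rpath_length gamma -> line_integral gamma rho < +oo ->
      upper_gradient_along u (G n) gamma.
  by move=> n; have /(weak_upper_gradientP bmu)[_ _ [rho ? ?]] := wG n; exists rho.
have bG n : borel_fun (G n) by case: (wG n).
have G0 n x : 0 <= G n x by case: (wG n).
have [srho [dsrho Hsrho]] := density_series bmu (fun n => (Hrho n).1).
have dG0 : density mu (G 0%N) by split.
apply/(weak_upper_gradientP bmu); split.
- exact: borel_fun_inf_noninc.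
- by move=> x; apply: le_ereal_inf_tmp => _ [n _ <-].
have [bs s0 _] := dsrho.
exists (srho \+ G 0%N); first exact: densityD.
move=> gamma lg fing.
have fs : line_integral gamma srho < +oo.
  by apply: line_integral_lty fing => //= [|x]; [exact: borel_funD|rewrite leeDl].
have fG : line_integral gamma (G 0%N) < +oo.
  by apply: line_integral_lty fing => //= [|x]; [exact: borel_funD|rewrite leeDr].
have ug n : upper_gradient_along u (G n) gamma.
  by apply: (Hrho n).2 => //; exact: Hsrho.
rewrite /upper_gradient_along line_integralE.
have mG n := measurable_funTS (D := `[0%R, fine (rpath_length gamma)]%classic) (measurable_fun_arc gamma (bG n)).
have [] := @dominated_convergence _ _ _ lebesgue `[0%R, fine (rpath_length gamma)]%classic
  (measurable_itv _) (fun n => G n \o arc_param_clamp gamma)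
  ((fun x => ereal_inf (range (G^~ x))) \o arc_param_clamp gamma)
  (G 0%N \o arc_param_clamp gamma) mG.
- apply: measurable_funTS; apply: measurable_fun_arc.
  exact: borel_fun_inf_noninc.
- by apply: aeW => s _ /=; exact: ereal_nonincreasing_cvgn.
- apply/integrableP; split; first exact: mG.
  under eq_integral do rewrite gee0_abs/= ?G0//.
  by rewrite -line_integralE.
- by apply: aeW => s n _ /=; rewrite gee0_abs//; exact: Gn.
move=> _ _ cv; rewrite -(cvg_lim _ cv)//; apply: lime_ge.
  by apply/cvg_ex; eexists; exact: cv.
by near=> n; have := ug n; rewrite /upper_gradient_along line_integralE.
Unshelve. all: by end_near. Qed.

Lemma integrable_loc_integrable g : borel_fun g -> (forall x, 0 <= g x) ->
  Int g < +oo -> loc_integrable mu g.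
Proof.
move=> bg g0 fin x; exists 1%R => //; apply: le_lt_trans fin.
apply: ge0_subset_integral => //; first exact: measurable_metric_ball.
exact: borel_fun_cara.
Qed.

Lemma min_weak_upper_gradient_exists v g0 :
  weak_upper_gradient mu (EFin \o v) g0 -> Int g0 < +oo ->
  exists g, min_weak_upper_gradient mu (EFin \o v) g.
Proof.
move=> wg0 fin0.
pose W := [set g | weak_upper_gradient mu (EFin \o v) g /\ Int g < +oo].
pose Inf := ereal_inf [set Int g | g in W].
have Wge g : W g -> Inf <= Int g by move=> Wg; apply: ereal_inf_lbound; exists g.
have I0 : 0 <= Inf.
  by apply: le_ereal_inf_tmp => _ [g [[_ g0' _] _] <-]; exact: integral_ge0.
have Ifin : Inf \is a fin_num.
  by rewrite ge0_fin_numE//; apply: (le_lt_trans _ fin0); apply: Wge; split.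
have /choice[g_ Hg_] : forall n : nat, exists g, W g /\ Int g <= Inf + (n.+1%:R^-1)%:E.
  move=> n; have e0 : (0 < n.+1%:R^-1 :> R)%R by rewrite invr_gt0.
  have [_ [g Wg <-] /ltW H] := lb_ereal_inf_adherent e0 Ifin.
  by exists g.
have Wmin f g : W f -> weak_upper_gradient mu (EFin \o v) g ->
    loc_integrable mu g -> W (fun x => mine (f x) (g x)).
  move=> [wf ff] wg lg; split; first exact: weak_upper_gradient_mine.
  have [bf f0 _] := wf; have [bg g0' _] := wg.
  apply: le_lt_trans ff; apply: integral_cara_le => //.
  - exact: borel_fun_mine.
  - by move=> x; rewrite le_min f0 g0'.
  - by move=> x; rewrite ge_min lexx.
have Wloc g : W g -> loc_integrable mu g.
  by move=> [[bg g0' _] fin]; exact: integrable_loc_integrable.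
(* Running minima turn the minimizing sequence into a decreasing one without leaving [W]. *)
pose G := fix G n : X -> \bar R :=
  if n is m.+1 then (fun x => mine (G m x) (g_ m.+1 x)) else g_ 0%N.
have WG n : W (G n).
  elim: n => [|n IH] /=; first by case: (Hg_ 0%N).
  by apply: Wmin => //; [case: (Hg_ n.+1) => -[]|apply: Wloc; exact: (Hg_ n.+1).1].
have GS n x : G n.+1 x <= G n x by rewrite /= ge_min lexx.
have Gg n x : G n x <= g_ n x by case: n => [|n] //=; rewrite ge_min lexx orbT.
have Gn x : {homo G^~ x : n m / (n <= m)%N >-> m <= n}.
  by apply/nonincreasing_seqP => n; exact: GS.
pose g x := ereal_inf (range (G^~ x)).
have gG n x : g x <= G n x by apply: ereal_inf_lbound; exists n.
have wg : weak_upper_gradient mu (EFin \o v) g.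
  apply: weak_upper_gradient_inf_noninc => //.
  - by move=> n; case: (WG n).
  - by case: (WG 0%N).
have [bg g0' _] := wg.
have Ig : Int g <= Inf.
  apply/lee_addgt0Pr => e e0.
  have [n ne] := inv_nat_small e0.
  apply: (@le_trans _ _ (Int (g_ n))).
    apply: integral_cara_le => //; first by case: (Hg_ n) => -[[]].
    by move=> x; exact: le_trans (Gg n x).
  by apply: le_trans (Hg_ n).2 _; rewrite leeD2l// lee_fin ltW.
have Wg : W g by split => //; apply: le_lt_trans Ig _; rewrite -ge0_fin_numE.
have lg := Wloc g Wg.
(* The minimum [m] of [g] and a competitor [g'] belongs to [W], so its integral is no smaller than
   that of [g]. As [m <= g] and both are integrable, they agree almost everywhere, which gives
   [g <= g']. *)
exists g; split => // g' wg' lg'.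
have [bg' g0'' _] := wg'.
pose m x := mine (g x) (g' x).
have Wm : W m by exact: Wmin.
have [[bm m0 _] mfin] := Wm.
have mg x : m x <= g x by rewrite /m ge_min lexx.
have Igm : Int g = Int m.
  apply/eqP; rewrite eq_le (le_trans Ig (Wge _ Wm))/=.
  exact: integral_cara_le.
have gint : (cara_measure mu).-integrable setT g.
  apply/integrableP; split; first exact: borel_fun_cara.
  by under eq_integral do rewrite gee0_abs//; case: Wg.
have mint : (cara_measure mu).-integrable setT m.
  apply/integrableP; split; first exact: borel_fun_cara.
  by under eq_integral do rewrite gee0_abs//.
have gfin := integrable_ae measurableT gint.
have mfin' : Int m \is a fin_num by rewrite ge0_fin_numE// integral_ge0.
have : \int[cara_measure mu]_x `|(g \- m) x| = 0.
  transitivity (\int[cara_measure mu]_x (g \- m) x).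
    apply: ae_eq_integral => //.
    - apply: measurableT_comp => //; apply: emeasurable_funB; exact: borel_fun_cara.
    - apply: emeasurable_funB; exact: borel_fun_cara.
    - apply: filterS gfin => x /= gx _.
      have gx1 : g x \is a fin_num by exact: gx.
      by rewrite gee0_abs// sube_ge0 ?gx1 ?orbT//; exact: mg.
  by rewrite integralB// Igm subee.
move/ae_eq_integral_abs => H.
have {}H : ae_eq (cara_measure mu) setT (g \- m) (cst 0).
  by apply: H => //; apply: emeasurable_funB; exact: borel_fun_cara.
apply: filterS2 gfin H => x gx gm.
have {}gm : g x - m x = 0 by exact: gm.
have gmx : g x = m x.
  have mx : m x \is a fin_num.
    rewrite ge0_fin_numE//; apply: le_lt_trans (mg x) _.
    by rewrite -ge0_fin_numE// gx.
  by rewrite -[LHS](@subeK _ _ (m x))// gm add0e.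
by rewrite gmx /m ge_min lexx orbT.
Qed.

End MinimalWeakUpperGradientExists.

(** * Passing to real-valued functions *)

Section RealValuedRepresentative.
Context {R : realType} {X : pmetricType R}.
Variable mu : {outer_measure set X -> \bar R}.
Hypothesis mmu : metric_measure_space mu.
Local Open Scope ereal_scope.
Implicit Types (u g gu : X -> \bar R) (gamma : rpath X).
Local Notation "'Int' f" := (\int[cara_measure mu]_x f x) (at level 10, f at level 9).
Local Notation caraT := (caratheodory_type mu).

Let bmu : borel_regular mu. Proof. by case: mmu. Qed.

Lemma upper_gradient_weak u g : upper_gradient u g -> weak_upper_gradient mu u g.
Proof.
move=> [bg g0 H]; split => //; exists set0; last by move=> gamma lg _; exact: H.
apply/(modulus1_eq0P bmu); exists (fun=> 0) => //; split => //; first exact: borel_cst.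
by rewrite integral0.
Qed.

Lemma abse_sub_fin_num (x y : \bar R) : `|x - y| < +oo ->
  (x \is a fin_num) && (y \is a fin_num).
Proof. by case: x => [x| |]; case: y => [y| |]. Qed.

(** Minimality as defined only gives local integrability; the integrable upper gradient of a
    Newton-Sobolev function is a competitor and dominates [gu] almost everywhere. *)
Lemma min_weak_upper_gradient_integrable u gu : newton_sobolev11 mu u ->
  min_weak_upper_gradient mu u gu -> Int gu < +oo.
Proof.
move=> [_ [g ug ig]] [[bgu gu0 _] _ min_gu].
have [bg g0 _] := ug.
have fin : Int g < +oo.
  have /integrableP[_] := ig; by under eq_integral do rewrite gee0_abs//.
have aeg : {ae cara_measure mu, forall x, gu x <= g x}.
  apply: min_gu; first exact: upper_gradient_weak.
  exact: integrable_loc_integrable.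
apply: le_lt_trans fin; apply: ae_ge0_le_integral => //.
- exact: borel_fun_cara.
- exact: borel_fun_cara.
- by apply: (@filterS caraT _ _ _ _ _ aeg) => x.
Qed.

(* Almost every nonconstant path has endpoints where [u] is finite, so that
   replacing the infinite values of [u] by 0 does not affect its weak upper
   gradients. *)
Lemma min_weak_upper_gradient_fine u gu : newton_sobolev11 mu u ->
  min_weak_upper_gradient mu u gu ->
  min_weak_upper_gradient mu (EFin \o (fine \o u)) gu.
Proof.
move=> nu mgu; have fin := min_weak_upper_gradient_integrable nu mgu.
have [/(weak_upper_gradientP bmu)[bgu gu0 [rho1 d1 H1]] lgu min_gu] := mgu.
have dgu : density mu gu by [].
have d2 := densityD bmu d1 dgu.
have [b1 r10 _] := d1; have [b2 r20 _] := d2.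
have finu gamma : 0 < rpath_length gamma -> line_integral gamma (rho1 \+ gu) < +oo ->
    (u (gamma (rpath_start gamma)) \is a fin_num) &&
    (u (gamma (rpath_end gamma)) \is a fin_num).
  move=> lg fing; apply: abse_sub_fin_num.
  apply: le_lt_trans (H1 gamma lg _) _.
    by apply: line_integral_lty fing => //= x; rewrite leeDl.
  by apply: line_integral_lty fing => //= x; rewrite leeDr.
split => //.
  apply/(weak_upper_gradientP bmu); split => //; exists (rho1 \+ gu) => //.
  move=> gamma lg fing; have /andP[ua ub] := finu _ lg fing.
  rewrite /upper_gradient_along [X in `|X|](_ : _ = u (gamma (rpath_start gamma)) -
    u (gamma (rpath_end gamma))); last by rewrite /= EFinN !fineK.
  apply: H1 => //.
  by apply: line_integral_lty fing => //= x; rewrite leeDl.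
move=> g' /(weak_upper_gradientP bmu)[bg' g'0 [rho' d' H']] lg'.
apply: min_gu => //; apply/(weak_upper_gradientP bmu); split => //.
have [b' r'0 _] := d'; have [b3 r30 _] := densityD bmu d2 d'.
exists ((rho1 \+ gu) \+ rho'); first exact: densityD.
move=> gamma lg fing.
have /andP[ua ub] : (u (gamma (rpath_start gamma)) \is a fin_num) &&
    (u (gamma (rpath_end gamma)) \is a fin_num).
  by apply: finu => //; apply: line_integral_lty fing => //= x; rewrite leeDl.
have := H' gamma lg; rewrite /upper_gradient_along.
rewrite [X in `|X|](_ : _ = u (gamma (rpath_start gamma)) -
    u (gamma (rpath_end gamma))); last by rewrite /= EFinN !fineK.
apply.
apply: line_integral_lty fing => //= x; rewrite leeDr//.
Qed.

End RealValuedRepresentative.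

(** * Poincare inequality along chains *)

Section PoincareChain.
Context {R : realType} {X : pmetricType R}.
Variable mu : {outer_measure set X -> \bar R}.
Hypothesis mmu : metric_measure_space mu.
Local Open Scope ereal_scope.
Implicit Types (u : X -> R) (gu : X -> \bar R) (x y : X) (r D : R).
Local Notation "'Int' f" := (\int[cara_measure mu]_x f x) (at level 10, f at level 9).
Local Notation caraT := (caratheodory_type mu).

Let bmu : borel_regular mu. Proof. by case: mmu. Qed.

Definition sobolev_pair u gu :=
  [/\ (cara_measure mu).-integrable setT (EFin \o u),
      min_weak_upper_gradient mu (EFin \o u) gu & Int gu < +oo].

Definition ball_mean r u x : R := fine (avg mu (ball x r) (EFin \o u)).

Definition ball_mass D gu x : R := fine (\int[cara_measure mu]_(y in ball x D) gu y).

Lemma ball_massE D u gu x : sobolev_pair u gu ->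
  \int[cara_measure mu]_(y in ball x D) gu y = (ball_mass D gu x)%:E.
Proof.
move=> [_ [[bg g0 _] _ _] fin]; rewrite fineK// ge0_fin_numE ?integral_ge0//.
apply: le_lt_trans fin; apply: ge0_subset_integral => //.
- exact: measurable_metric_ball.
- exact: borel_fun_cara.
Qed.

Lemma ball_mass_ge0 D u gu x : sobolev_pair u gu -> (0 <= ball_mass D gu x)%R.
Proof. by move=> [_ [[_ g0 _] _ _] _]; rewrite fine_ge0// integral_ge0. Qed.

Lemma ball_mass_le D D' u gu x y : sobolev_pair u gu ->
  (mdist x y + D <= D')%R -> (ball_mass D gu y <= ball_mass D' gu x)%R.
Proof.
move=> sp DD'; rewrite -lee_fin -!(ball_massE _ _ sp).
have [_ [[bg g0 _] _ _] _] := sp; apply: ge0_subset_integral => //.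
- exact: measurable_metric_ball.
- exact: measurable_metric_ball.
- exact: borel_fun_cara.
- move=> z; rewrite !ballEmdist/= => yz.
  by apply: le_lt_trans (metric_triangle x y z) _; lra.
Qed.

Lemma measurable_dist_cst u (c : R) (D : set caraT) :
  (cara_measure mu).-integrable setT (EFin \o u) ->
  measurable_fun D (fun y => `|u y - c|%:E : \bar R).
Proof.
move=> /integrableP[mu_ _]; apply: measurable_funTS.
apply/measurable_EFinP; apply: measurableT_comp => //.
by apply: measurable_funB => //; exact/measurable_EFinP.
Qed.

(** The Poincare inequality at the single scale [RP], with the averages multiplied out: uniformity
    makes the measures of the balls positive and finite, and the ratio of the smaller to the larger
    is at most 1. *)
Lemma poincare_mean : uniform_mms mu -> local_weak_poincare11 mu ->
  exists r C tau : R, [/\ (0 < r)%R, (0 < C)%R, (1 <= tau)%R &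
    forall u gu x, sobolev_pair u gu ->
      \int[cara_measure mu]_(y in ball x r) `|u y - ball_mean r u x|%:E
        <= (C * ball_mass (tau * r) gu x)%:E].
Proof.
move=> [f [g [fg0 _ fg]]] [CP [RP [tau [CP0 RP0 tau1 HP]]]].
exists RP, (CP * RP)%R, tau; split => //; first by rewrite mulr_gt0.
move=> u gu x sp.
have RPle : (0 < RP <= RP)%R by rewrite RP0 lexx.
have tau0 : (0 < tau)%R by exact: lt_le_trans tau1.
have tRP : (0 < tau * RP)%R by rewrite mulr_gt0.
have [_ /(_ u gu)] := HP x RP RPle.
have [iu mgu fing] := sp.
have iu' : (cara_measure mu).-integrable (ball x (tau * RP)%R) (EFin \o u).
  by apply: integrableS iu => //; exact: measurable_metric_ball.
move=> /(_ iu' mgu); rewrite -/(ball_mean RP u x) /avg (ball_massE _ _ sp).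
have pos (s : R) : (0 < s)%R -> exists2 a : R, mu (ball x s) = a%:E & (0 < a)%R.
  move=> s0; have [fs gs] := fg x s s0; have [fs0 _] := fg0 s s0.
  have afin : mu (ball x s) \is a fin_num.
    rewrite ge0_fin_numE; first exact: le_lt_trans gs (ltry _).
    exact: outer_measure_ge0.
  by exists (fine (mu (ball x s))); rewrite ?fineK// -lte_fin fineK//;
    apply: lt_le_trans fs; rewrite lte_fin.
have [a aE a0] := pos _ RP0; have [b bE b0] := pos _ tRP.
have ab : (a <= b)%R.
  rewrite -lee_fin -aE -bE; apply: le_outer_measure => y.
  rewrite !ballEmdist/= => /lt_le_trans; apply.
  by rewrite ler_peMl// ltW.
set J := integral _ _ _.
rewrite aE bE !inver (gt_eqF a0) (gt_eqF b0) -!EFinM => H.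
have -> : J = a%:E * ((a^-1)%:E * J).
  by rewrite muleA -EFinM divff ?gt_eqF// mul1e.
apply: (@le_trans _ _ (a%:E * (CP * RP * (b^-1 * ball_mass (tau * RP) gu x))%:E)).
  by apply: lee_wpmul2l => //; rewrite lee_fin ltW.
rewrite -EFinM lee_fin mulrCA ler_wpM2l//; first by rewrite mulr_ge0 ?ltW.
rewrite mulrA ler_piMl ?(ball_mass_ge0 _ _ sp)//.
by rewrite ler_pdivrMr// mul1r.
Qed.

Section Chain.
Variables (r C tau : R).
Hypotheses (r0 : (0 < r)%R) (C0 : (0 < C)%R) (tau1 : (1 <= tau)%R).
Hypothesis HP : forall u gu x, sobolev_pair u gu ->
  \int[cara_measure mu]_(y in ball x r) `|u y - ball_mean r u x|%:E
    <= (C * ball_mass (tau * r) gu x)%:E.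
Hypothesis umu : uniform_mms mu.

(** Both means are compared with [u] on the ball of radius [r / 2] about [x], which lies in both
    balls and has measure at least [f (r / 2)]. The radius [(tau + 1) * r] contains the enlarged
    ball about [y]. *)
Lemma ball_mean_step : exists2 K : R, (0 < K)%R & forall u gu x y,
  sobolev_pair u gu -> (mdist x y <= r / 2)%R ->
  (`|ball_mean r u x - ball_mean r u y| <= K * ball_mass ((tau + 1) * r) gu x)%R.
Proof.
have [f [g [fg0 _ fg]]] := umu.
have r20 : (0 < r / 2)%R by rewrite divr_gt0.
have [f0 _] := fg0 _ r20.
exists (2 * C / f (r / 2))%R; first by rewrite divr_gt0// mulr_gt0.
move=> u gu x y sp xy; have [iu mgu fing] := sp.
set c := `| _ |%R; set M := ball_mass _ _ _.
have c0 : (0 <= c)%R by rewrite normr_ge0.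
rewrite mulrAC ler_pdivlMr// mulrC -lee_fin EFinM.
pose B : set caraT := ball x (r / 2)%R.
have mB : measurable B by exact: measurable_metric_ball.
have Bx : B `<=` ball x r.
  by move=> z; rewrite /B !ballEmdist/= => xz; lra.
have By : B `<=` ball y r.
  move=> z; rewrite /B !ballEmdist/= => xz.
  by apply: le_lt_trans (metric_triangle y x z) _; rewrite (metric_sym y); lra.
have mux : forall z, measurable_fun B (fun w : X => `|u w - z|%:E) by move=> z; exact: measurable_dist_cst.
have H s : B `<=` ball s r -> (mdist x s + tau * r <= (tau + 1) * r)%R ->
    \int[cara_measure mu]_(w in B) `|u w - ball_mean r u s|%:E <= (C * M)%:E.
  move=> Bs xs; apply: (@le_trans _ _ (C * ball_mass (tau * r) gu s)%:E); last first.
    by rewrite lee_fin ler_wpM2l ?(ltW C0)//; exact: ball_mass_le sp xs.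
  apply: le_trans (HP s sp); apply: ge0_subset_integral => //.
  - exact: measurable_metric_ball.
  - exact: measurable_dist_cst.
apply: (@le_trans _ _ (\int[cara_measure mu]_(w in B) c%:E)).
  rewrite integral_cst// muleC lee_wpmul2l//.
  by case: (fg x _ r20).
apply: (@le_trans _ _ (\int[cara_measure mu]_(w in B)
    (`|u w - ball_mean r u x|%:E + `|u w - ball_mean r u y|%:E))).
  apply: ge0_le_integral => //; first by apply: emeasurable_funD.
  by move=> w _; rewrite -EFinD lee_fin /c (distrC (u w)); exact: ler_distD.
rewrite ge0_integralD//.
apply: (@le_trans _ _ ((C * M)%:E + (C * M)%:E)); last first.
  by rewrite -EFinD lee_fin; lra.
by apply: leeD; apply: H => //; rewrite ?mdistxx; lra.
Qed.

Lemma ball_mean_chain D : quasiconvex X -> (0 < D)%R -> exists K D' : R,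
  [/\ (0 < K)%R, (0 < D')%R & forall u gu x y, sobolev_pair u gu ->
    (mdist x y <= D)%R ->
    (`|ball_mean r u x - ball_mean r u y| <= K * ball_mass D' gu x)%R].
Proof.
move=> [Q Q1 qc] D0; have [K K0 HK] := ball_mean_step.
have Q0 : (0 < Q)%R by exact: lt_le_trans Q1.
have QD0 : (0 < Q * D)%R by rewrite mulr_gt0.
have [n nP] : exists n : nat, (Q * D / n.+1%:R <= r / 2)%R.
  have e0 : (0 < r / 2 / (Q * D))%R by rewrite !divr_gt0.
  have [k ke] := inv_nat_small e0.
  by exists k; rewrite mulrC -ler_pdivlMr// ltW.
exists (n.+1%:R * K)%R, (Q * D + (tau + 1) * r)%R; split.
- by rewrite mulr_gt0.
- by rewrite addr_gt0// mulr_gt0// addr_gt0// (lt_le_trans _ tau1).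
move=> u gu x y sp; have [gamma [<- <- lg]] := qc x y => xy.
set J := ball_mass _ _ _.
(* The path is cut into [n + 1] pieces of equal arc length, at most [r / 2] each. All cut points
   stay within [Q * D] of the start, so one enlarged ball about [x] serves for every step. *)
pose L := fine (rpath_length gamma).
have L0 : (0 <= L)%R by exact: fine_rpath_length_ge0.
have LQ : (L <= Q * D)%R.
  rewrite -lee_fin /L rpath_lengthE/= -rpath_lengthE; apply: le_trans lg _.
  by rewrite lee_fin ler_pM2l.
pose p (i : nat) := arc_param_clamp gamma (i%:R * (L / n.+1%:R))%R.
have p0 : p 0%N = gamma (rpath_start gamma) by rewrite /p mul0r arc_param_clamp_start.
have pn : p n.+1 = gamma (rpath_end gamma).
  by rewrite /p mulrC divfK ?pnatr_eq0// arc_param_clamp_end.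
rewrite -p0 -pn.
have step i : (mdist (p i) (p i.+1) <= r / 2)%R.
  apply: le_trans (arc_param_clamp_lip _ _ _) _.
  rewrite -mulrBl -natr1 opprD addrA subrr sub0r mulN1r normrN ger0_norm ?divr_ge0//.
  by apply: le_trans nP; rewrite ler_wpM2r// invr_ge0.
have far i : (i <= n.+1)%N -> (mdist (p 0%N) (p i) <= Q * D)%R.
  move=> iln; apply: le_trans (arc_param_clamp_lip _ _ _) _.
  rewrite mul0r sub0r normrN ger0_norm ?mulr_ge0 ?divr_ge0//.
  apply: le_trans LQ; rewrite mulrCA ler_piMr// ler_pdivrMr// mul1r ler_nat//.
suff H i : (i <= n.+1)%N ->
    (`|ball_mean r u (p 0%N) - ball_mean r u (p i)| <= i%:R * K * J)%R.
  exact: H.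
elim: i => [|i IH] iln; first by rewrite subrr normr0 !mul0r.
apply: le_trans (ler_distD (ball_mean r u (p i)) _ _) _.
rewrite -natr1 mulrDl mul1r mulrDl lerD ?IH 1?ltnW//.
apply: le_trans (HK u gu _ _ sp (step i)) _; rewrite ler_wpM2l ?(ltW K0)//.
by apply: ball_mass_le sp _; rewrite lerD2r -p0; apply: far; exact: ltnW.
Qed.

End Chain.

End PoincareChain.

(** * Interpolation along a partition of unity *)

Lemma sum_cst_count (R : realType) (I : Type) (N : seq I) (P : pred I) (M : nat) (c : R) :
  0 <= c -> (size [seq z <- N | P z] <= M)%N ->
  \sum_(z <- N | P z) c <= M%:R * c.
Proof.
move=> c0 NM; rewrite big_const_seq -size_filter iter_addr_0 -[_ *+ _]mulr_natl.
by apply: ler_wpM2r => //; rewrite ler_nat.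
Qed.

Section Extension.
Context {R : realType} {Y : pmetricType R}.
Variables (N : seq Y) (a J : Y -> R) (o : Y) (r : R) (M : nat).

Definition hat (z w : Y) : R := Num.max 0 (2 - mdist w z).

Definition hat_sum (w : Y) : R := \sum_(z <- N) hat z w.

(* The interpolation of the values of [a] on the net [N] along the partition of
   unity associated to the hats; the truncation [Num.max 1] avoids dividing by
   zero away from the net. *)
Definition extension (w : Y) : R :=
  (\sum_(z <- N) a z * hat z w) / Num.max 1 (hat_sum w).

(** A local Lipschitz constant of [extension]: a hat of radius 2 that is nonzero somewhere in the
    unit ball about [w] is centred within 3 of [w], and [1 + M] is the Lipschitz constant of the
    normalized hats. *)
Definition extension_gradient (w : Y) : R :=
  (1 + M%:R) * \sum_(z <- N | mdist w z < 3) J z.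

Hypothesis J0 : forall z, 0 <= J z.
Hypothesis aJ : {in N &, forall z z', mdist z z' < 4 -> `|a z - a z'| <= J z}.
Hypothesis Ncover : forall w, mdist o w < r + 6 -> exists2 z, z \in N & mdist w z < 1.
Hypothesis asupp : {in N, forall z, r <= mdist o z -> a z = 0}.
Hypothesis Ncount : forall w, (size [seq z <- N | (mdist w z < 3)%R] <= M)%N.

Lemma hat_ge0 z w : 0 <= hat z w.
Proof. by rewrite le_max lexx. Qed.

Lemma hat_eq0 z w : 2 <= mdist w z -> hat z w = 0.
Proof. by move=> wz; rewrite /hat max_l// subr_le0. Qed.

Lemma hat_le2 z w : hat z w <= 2.
Proof. by rewrite ge_max ler0n gerBl mdist_ge0. Qed.

Lemma hat_lip z x y : `|hat z x - hat z y| <= mdist x y.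
Proof.
wlog xy : x y / hat z y <= hat z x.
  move=> H; have [|/ltW] := leP (hat z y) (hat z x); first exact: H.
  by rewrite distrC metric_sym; exact: H.
rewrite ger0_norm ?subr_ge0// lerBlDr ge_max addr_ge0 ?mdist_ge0 ?hat_ge0//=.
have : 2 - mdist y z <= hat z y by rewrite le_max lexx orbT.
have := metric_triangle y x z; rewrite (metric_sym y x); lra.
Qed.

Lemma hat_sum_ge1 w : mdist o w < r + 6 -> 1 <= hat_sum w.
Proof.
move=> /Ncover[z zN wz]; rewrite /hat_sum (big_rem z)//=.
have : 0 <= \sum_(y <- rem z N) hat y w by apply: sumr_ge0 => y _; exact: hat_ge0.
have : 2 - mdist w z <= hat z w by rewrite le_max lexx orbT.
lra.
Qed.

Lemma hat_le_sum z w : z \in N -> hat z w <= hat_sum w.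
Proof.
move=> zN; rewrite /hat_sum (big_rem z)//= lerDl.
by apply: sumr_ge0 => y _; exact: hat_ge0.
Qed.

Lemma hat_sum_lip w x y : mdist w x < 1 -> mdist w y < 1 ->
  `|hat_sum x - hat_sum y| <= M%:R * mdist x y.
Proof.
move=> wx wy; rewrite /hat_sum -sumrB.
apply: le_trans (ler_norm_sum _ _ _) _.
apply: (@le_trans _ _ (\sum_(z <- N | mdist w z < 3) mdist x y)).
  rewrite [leRHS]big_mkcond/=; apply: ler_sum => z _.
  case: ifPn => [_|]; first exact: hat_lip.
  rewrite -leNgt => wz; have := metric_triangle w x z.
  have := metric_triangle w y z => H1 H2.
  by rewrite !hat_eq0 ?subrr ?normr0//; lra.
by apply: sum_cst_count => //; exact: mdist_ge0.
Qed.

Lemma extension_gradient_ge0 w : 0 <= extension_gradient w.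
Proof.
by rewrite mulr_ge0// ?addr_ge0// sumr_ge0.
Qed.

Lemma extension_eq0 w : r + 2 <= mdist o w -> extension w = 0.
Proof.
move=> ow; rewrite /extension big_seq big1 ?mul0r// => z zN.
have [rz|rz] := leP r (mdist o z); first by rewrite asupp// mul0r.
rewrite hat_eq0 ?mulr0//.
by have := metric_triangle o z w; rewrite (metric_sym z w); lra.
Qed.

Lemma extensionE w : 1 <= hat_sum w ->
  extension w = \sum_(z <- N) a z * (hat z w / hat_sum w).
Proof.
move=> Sw; rewrite /extension max_r// mulr_suml.
by apply: eq_bigr => z _; rewrite mulrA.
Qed.

Lemma hat_sum1 w : 1 <= hat_sum w -> \sum_(z <- N) hat z w / hat_sum w = 1.
Proof.
by move=> Sw; rewrite -mulr_suml divff// gt_eqF// (lt_le_trans _ Sw).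
Qed.

Lemma extension_subE w c : 1 <= hat_sum w ->
  extension w - c = \sum_(z <- N) (a z - c) * (hat z w / hat_sum w).
Proof.
move=> Sw; rewrite extensionE//.
under [RHS]eq_bigr do rewrite mulrBl.
by rewrite sumrB -mulr_sumr hat_sum1// mulr1.
Qed.

(** The quotient is varied in two steps: the change of the numerator costs 1, that of the
    denominator costs [M], the denominators being at least 1. *)
Lemma normalized_hat_lip w x y z : z \in N -> mdist w x < 1 -> mdist w y < 1 ->
  1 <= hat_sum x -> 1 <= hat_sum y ->
  `|hat z x / hat_sum x - hat z y / hat_sum y| <= (1 + M%:R) * mdist x y.
Proof.
move=> zN wx wy Sx Sy.
have Sx0 : 0 < hat_sum x by rewrite (lt_le_trans _ Sx).
have Sy0 : 0 < hat_sum y by rewrite (lt_le_trans _ Sy).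
have -> : hat z x / hat_sum x - hat z y / hat_sum y =
    (hat z x - hat z y) / hat_sum x +
    (hat z y / hat_sum y) * ((hat_sum y - hat_sum x) / hat_sum x).
  by field; rewrite !gt_eqF.
rewrite [leRHS]mulrDl mul1r; apply: le_trans (ler_normD _ _) _; apply: lerD.
  rewrite normrM normfV (gtr0_norm Sx0) ler_pdivrMr//.
  apply: le_trans (hat_lip z x y) _.
  by rewrite ler_peMr// mdist_ge0.
rewrite normrM ger0_norm; last by rewrite divr_ge0 ?hat_ge0// ltW.
rewrite -[leRHS]mul1r; apply: ler_pM => //.
- by rewrite divr_ge0 ?hat_ge0// ltW.
- by rewrite ler_pdivrMr// mul1r hat_le_sum.
- rewrite normrM normfV (gtr0_norm Sx0) ler_pdivrMr// distrC.
  apply: le_trans (hat_sum_lip wx wy) _.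
  by rewrite ler_peMr// mulr_ge0// mdist_ge0.
Qed.

Lemma extension_lip w x y : mdist w x < 1 -> mdist w y < 1 ->
  `|extension x - extension y| <= extension_gradient w * mdist x y.
Proof.
(* Beyond [r + 4] the interpolation vanishes on the whole unit ball about [w]; otherwise that ball
   stays within [r + 6], where the net covers and the truncation is inactive. *)
move=> wx wy; have [ow|ow] := leP (r + 4) (mdist o w).
  have H p : mdist w p < 1 -> extension p = 0.
    move=> wp; apply: extension_eq0.
    by have := metric_triangle o p w; rewrite (metric_sym p w); lra.
  by rewrite !H// subrr normr0 mulr_ge0 ?extension_gradient_ge0 ?mdist_ge0.
have H p : mdist w p < 1 -> 1 <= hat_sum p.
  by move=> wp; apply: hat_sum_ge1; have := metric_triangle o w p; lra.
have Sx := H x wx; have Sy := H y wy.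
have [|z0 z0N wz0] := Ncover (w := w); first lra.
(* As the normalized hats sum to 1, the constant [a z0] can be subtracted from all values. Only
   differences [a z - a z0] with [z] within 3 and [z0] within 1 of [w] remain, whence the distance 4
   in [aJ]. *)
rewrite -[extension x](subrK (a z0)) -addrA -[a z0 - _]opprB.
rewrite !extension_subE// -sumrB.
apply: le_trans (ler_norm_sum _ _ _) _.
rewrite /extension_gradient mulrAC mulr_sumr [leRHS]big_mkcond/= big_seq [leRHS]big_seq.
apply: ler_sum => z zN.
rewrite -mulrBr; case: ifPn => [wz|].
  rewrite normrM mulrC; apply: ler_pM => //.
    exact: normalized_hat_lip wx wy Sx Sy.
  apply: aJ => //; have := metric_triangle z w z0; rewrite (metric_sym z w); lra.
rewrite -leNgt => wz.
rewrite !hat_eq0 ?mul0r ?subrr ?mulr0 ?normr0//.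
  by have := metric_triangle w y z; lra.
by have := metric_triangle w x z; lra.
Qed.

(** The value [extension w] is a convex combination of values at net points within 2 of [w], each
    differing from [a z] by at most [J]. Integrated over small balls, this recovers the sum of the
    values [a z] from the interpolation. *)
Lemma extension_lower z w : z \in N -> mdist w z < 2^-1 ->
  `|a z| <= `|extension w| + extension_gradient w.
Proof.
move=> zN wz; have [oz|oz] := leP r (mdist o z).
  by rewrite asupp// normr0 addr_ge0// extension_gradient_ge0.
have Sw : 1 <= hat_sum w.
  by apply: hat_sum_ge1; have := metric_triangle o z w; rewrite (metric_sym z w); lra.
have Sw0 : 0 < hat_sum w by rewrite (lt_le_trans _ Sw).
rewrite -[a z](subKr (extension w)); apply: le_trans (ler_normB _ _) _.
rewrite lerD2l extension_subE//.
apply: le_trans (ler_norm_sum _ _ _) _.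
rewrite /extension_gradient.
apply: (@le_trans _ _ (\sum_(z <- N | mdist w z < 3) J z)); last first.
  by rewrite ler_peMl ?sumr_ge0// lerDl.
rewrite [leRHS]big_mkcond/= big_seq [leRHS]big_seq; apply: ler_sum => z' z'N.
case: ifPn => [wz'|]; last first.
  by rewrite -leNgt => wz'; rewrite hat_eq0 ?mul0r ?mulr0 ?normr0//; lra.
rewrite normrM -[leRHS]mulr1; apply: ler_pM => //.
  apply: aJ => //; have := metric_triangle z' w z; rewrite (metric_sym z' w); lra.
rewrite ger0_norm; last by rewrite divr_ge0 ?hat_ge0// ltW.
by rewrite ler_pdivrMr// mul1r hat_le_sum.
Qed.

Lemma extension_bounded w : `|extension w| <= 2 * \sum_(z <- N) `|a z|.
Proof.
have m0 : 1 <= Num.max 1 (hat_sum w) by rewrite le_max lexx.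
have m1 : 0 < Num.max 1 (hat_sum w) by rewrite (lt_le_trans _ m0).
rewrite /extension normrM normfV (gtr0_norm m1) ler_pdivrMr//.
apply: (@le_trans _ _ (2 * \sum_(z <- N) `|a z|)); last first.
  by rewrite ler_peMr// mulr_ge0// sumr_ge0.
apply: le_trans (ler_norm_sum _ _ _) _; rewrite mulr_sumr; apply: ler_sum => z _.
by rewrite normrM mulrC ler_wpM2r// ger0_norm ?hat_ge0// hat_le2.
Qed.

End Extension.

(** * Sobolev inequality for an explicit upper gradient *)

Section SobolevUpperGradient.
Context {R : realType} {X : pmetricType R}.
Local Open Scope ereal_scope.
Local Notation borelT := (g_sigma_algebraType (@open X)).
Local Notation lebesgue := (@lebesgue_measure R).

Lemma continuous_borel (v : X -> R) : continuous v ->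
  measurable_fun setT (v : borelT -> R).
Proof.
move=> cv; apply: (@measurability _ _ borelT _ _ _ _ (RGenOpens.measurableE R)).
move=> _ [_ [a [b ->]] <-]; rewrite setTI; apply: sub_sigma_algebra.
by move/continuousP : cv; apply; exact: interval_open.
Qed.

Lemma continuous_mdist (o : X) : continuous (mdist o).
Proof.
move=> x; apply/cvgrPdist_lt => e e0; near=> y.
have : (mdist x y < e)%R.
  by near: y; apply/nbhs_ballP; exists e => //= z; rewrite ballEmdist.
have := metric_triangle o x y; have := metric_triangle o y x.
by rewrite (metric_sym y x) ltr_norml => ? ? ?; apply/andP; split; lra.
Unshelve. all: by end_near. Qed.

Lemma control_function_ge1 (rho : R -> R) : control_function rho ->
  forall t, (0 <= t)%R -> (1 <= rho t)%R.
Proof. by move=> [_ mono r01 _] t t0; rewrite -r01; exact: mono. Qed.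

Lemma control_function_borel (rho : R -> R) (o : X) : control_function rho ->
  borel_fun (fun x => (rho (mdist o x))%:E).
Proof.
move=> [_ mono _ _]; pose rho' t := rho (Num.max 0 t)%R.
have mrho' : measurable_fun setT rho'.
  apply: nondecreasing_measurable => // s t st; apply: mono.
    by rewrite le_max lexx.
  by rewrite ge_max !le_max lexx/= st orbT.
apply/measurable_EFinP.
have -> : (fun x => rho (mdist o x)) = rho' \o mdist o.
  by apply/funext => x; rewrite /rho'/= max_r// mdist_ge0.
apply: (@measurableT_comp _ _ _ borelT) => //.
by apply: continuous_borel; exact: continuous_mdist.
Qed.

(** On a piece of length below 1 every intermediate point has both ends in its unit ball, so [G]
    dominates the difference quotient at every point of the piece; integrating and chaining such
    pieces gives the bound. *)
Lemma local_lipschitz_upper_gradient (v G : X -> R) :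
  borel_fun (EFin \o G) -> (forall x, 0 <= G x)%R ->
  (forall w x y, mdist w x < 1 -> mdist w y < 1 ->
    `|v x - v y| <= G w * mdist x y)%R ->
  upper_gradient (EFin \o v) (EFin \o G).
Proof.
move=> bG G0 vG; split => // gamma lg.
rewrite /upper_gradient_along line_integralE.
rewrite -arc_param_clamp_start -arc_param_clamp_end.
have mG := measurable_fun_arc gamma bG.
apply: (@integral_bound_local_to_global R (v \o arc_param_clamp gamma)
  ((EFin \o G) \o arc_param_clamp gamma) _ _ 1%R) => //; last exact: fine_rpath_length_ge0.
  by move=> x; rewrite /= lee_fin.
move=> s t s0 st tL ts1.
move: (st); rewrite le_eqVlt => /predU1P[->|st'].
  by rewrite subrr normr0; apply: integral_ge0 => x _; rewrite /= lee_fin.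
have ts0 : (0 < t - s)%R by rewrite subr_gt0.
set c := `| _ |%R.
have lst : lebesgue `[s, t]%classic = (t - s)%:E.
  by rewrite lebesgue_measure_itv/= lte_fin st' -EFinB.
have -> : c%:E = \int[lebesgue]_(r in `[s, t]) (c / (t - s))%:E.
  rewrite integral_cst; last exact: measurable_itv.
  by rewrite [X in _ * X]lst -EFinM divfK// gt_eqF.
apply: ge0_le_integral => //.
- by move=> r _; rewrite lee_fin divr_ge0 ?(ltW ts0)//; exact: normr_ge0.
- exact: measurable_funTS.
- move=> r /=; rewrite in_itv/= => /andP[sr rt].
  rewrite lee_fin ler_pdivrMr//.
  have H x : (s <= x)%R -> (x <= t)%R ->
      (mdist (arc_param_clamp gamma r) (arc_param_clamp gamma x) < 1)%R.
    move=> sx xt; apply: le_lt_trans (arc_param_clamp_lip _ _ _) _.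
    by rewrite ltr_norml; apply/andP; split; lra.
  apply: le_trans (vG _ _ _ (H s _ _) (H t _ _)) _ => //.
  apply: ler_wpM2l => //; apply: le_trans (arc_param_clamp_lip _ _ _) _.
  by rewrite distrC gtr0_norm.
Qed.

Variable mu : {outer_measure set X -> \bar R}.
Hypothesis mmu : metric_measure_space mu.
Hypothesis umu : uniform_mms mu.

Let bmu : borel_regular mu. Proof. by case: mmu. Qed.

Lemma sobolev_upper_gradient (rho : R -> R) (C : R) (o : X) (v G : X -> R) :
  control_function rho -> (0 < C)%R ->
  (forall u gu : X -> \bar R, newton_sobolev11 mu u -> bounded_support u ->
    min_weak_upper_gradient mu u gu ->
    \int[cara_measure mu]_x `|u x|
      <= C%:E * \int[cara_measure mu]_x (gu x * (rho (mdist o x))%:E)) ->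
  (cara_measure mu).-integrable setT (EFin \o v) ->
  bounded_support (EFin \o v) ->
  upper_gradient (EFin \o v) (EFin \o G) ->
  \int[cara_measure mu]_x (G x)%:E < +oo ->
  \int[cara_measure mu]_x `|v x|%:E
      <= C%:E * \int[cara_measure mu]_x ((G x)%:E * (rho (mdist o x))%:E).
Proof.
move=> crho C0 HS iv bv uG fG; have [bG G0 _] := uG.
have wG := upper_gradient_weak mmu uG.
have [gv mgv] := min_weak_upper_gradient_exists mmu umu wG fG.
have lG : loc_integrable mu (EFin \o G) by exact: integrable_loc_integrable.
have nv : newton_sobolev11 mu (EFin \o v).
  split => //; exists (EFin \o G) => //; apply/integrableP; split.
    exact: borel_fun_cara.
  by under eq_integral do rewrite gee0_abs//.
apply: le_trans (HS _ _ nv bv mgv) _; apply: lee_wpmul2l.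
  by rewrite lee_fin ltW.
have [[bgv gv0 _] _ /(_ _ wG lG) gvG] := mgv.
have rho0 x : 0 <= (rho (mdist o x))%:E.
  by rewrite lee_fin (le_trans ler01)// control_function_ge1// mdist_ge0.
have brho := control_function_borel o crho.
apply: ae_ge0_le_integral => //.
- by move=> x _; rewrite mule_ge0.
- by apply: emeasurable_funM; exact: borel_fun_cara.
- by move=> x _; rewrite mule_ge0//; exact: G0.
- apply: emeasurable_funM; last exact: borel_fun_cara.
  by move: bG; exact: borel_fun_cara.
- apply: (@filterS (caratheodory_type mu) _ _ _ _ _ gvG) => x gG _.
  by apply: lee_wpmul2r => //.
Qed.

End SobolevUpperGradient.

(** * Sums of integrals over balls with bounded overlap *)

Section BallSums.
Context {R : realType} {X : pmetricType R}.
Variable mu : {outer_measure set X -> \bar R}.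
Hypothesis mmu : metric_measure_space mu.
Local Open Scope ereal_scope.
Local Notation caraT := (caratheodory_type mu).

Lemma sum_restrict_ball (I : Type) (N : seq I) (c : I -> X) (D : R) (F : X -> \bar R) x :
  \sum_(i <- N) (F \_ (ball (c i) D)) x =
  \sum_(i <- N | (mdist x (c i) < D)%R) F x.
Proof.
rewrite [RHS]big_mkcond; apply: eq_bigr => i _; rewrite patchE.
congr (if _ then _ else _); rewrite metric_sym; apply/idP/idP.
  by move=> /set_mem; rewrite ballEmdist.
by move=> H; apply/mem_set; rewrite ballEmdist.
Qed.

Lemma sum_ball_integral_le (I : Type) (N : seq I) (c : I -> X) (D : R) (M : nat)
    (F : X -> \bar R) :
  measurable_fun setT (F : caraT -> \bar R) -> (forall x, 0 <= F x) ->
  (forall x, (size [seq i <- N | (mdist x (c i) < D)%R] <= M)%N) ->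
  \sum_(i <- N) \int[cara_measure mu]_(x in ball (c i) D) F x <=
    M%:R%:E * \int[cara_measure mu]_x F x.
Proof.
move=> mF F0 NM.
have mb i : measurable (ball (c i) D : set caraT) by exact: measurable_metric_ball.
under eq_bigr do rewrite integral_mkcond.
rewrite -ge0_integral_sum//; last 2 first.
- move=> i; apply/(@measurable_restrictT _ _ caraT _ _ F (mb i)).1.
  exact: measurable_funTS.
- by move=> i x _; rewrite patchE; case: ifP.
rewrite -ge0_integralZl//.
apply: ge0_le_integral => //.
- by move=> x _; rewrite sume_ge0// => i _; rewrite patchE; case: ifP.
- apply: emeasurable_sum => i.
  apply/(@measurable_restrictT _ _ caraT _ _ F (mb i)).1.
  exact: measurable_funTS.
- by apply: emeasurable_funM.
- move=> x _; rewrite sum_restrict_ball big_const_seq -size_filter.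
  have := NM x; set n := size _ => nM.
  have -> : iter n (GRing.add (F x)) 0 = n%:R%:E * F x.
    elim: n {nM} => [|n IH] /=; first by rewrite mul0e.
    by rewrite IH -natr1 EFinD ge0_muleDl ?lee_fin// mul1e addeC.
  by apply: lee_wpmul2r => //; rewrite lee_fin ler_nat.
Qed.

End BallSums.

(** * Integrals of the interpolation and its gradient *)

Section ExtensionIntegrals.
Context {R : realType} {Y : pmetricType R}.
Variable mu : {outer_measure set Y -> \bar R}.
Hypothesis mmu : metric_measure_space mu.
Local Open Scope ereal_scope.
Local Notation caraT := (caratheodory_type mu).
Variables (N : seq Y) (a J : Y -> R) (o : Y) (r : R) (M : nat).
Hypothesis J0 : forall z, (0 <= J z)%R.
Hypothesis aJ : {in N &, forall z z', mdist z z' < 4 -> `|a z - a z'| <= J z}%R.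
Hypothesis Ncover : forall w, (mdist o w < r + 6)%R -> exists2 z, z \in N & (mdist w z < 1)%R.
Hypothesis asupp : {in N, forall z, r <= mdist o z -> a z = 0}%R.
Hypothesis Ncount : forall w, (size [seq z <- N | (mdist w z < 3)%R] <= M)%N.

Let bmu : borel_regular mu. Proof. by case: mmu. Qed.
Let v := extension N a.
Let G := extension_gradient N J M.
Let G0 w : (0 <= G w)%R. Proof. exact: extension_gradient_ge0. Qed.

(** Reading [mdist w z < 3] as a condition on [w] turns the gradient into a finite combination of
    indicators of balls, which yields both its measurability and its weighted integrals. *)
Lemma extension_gradientM (W : Y -> \bar R) w :
  (G w)%:E * W w =
  \sum_(z <- N) ((1 + M%:R) * J z)%:E * (W \_ (ball z 3%R)) w.
Proof.
have -> : \sum_(z <- N) ((1 + M%:R) * J z)%:E * (W \_ (ball z 3%R)) w =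
    \sum_(z <- N) ((fun w => ((1 + M%:R) * J z)%:E * W w) \_ (ball z 3%R)) w.
  by apply: eq_bigr => z _; rewrite !patchE; case: ifP => // _; rewrite mule0.
rewrite /G /extension_gradient mulr_sumr -sumEFin big_mkcond/=.
rewrite ge0_sume_distrl; last first.
  move=> z _; case: ifP => // _; by rewrite lee_fin mulr_ge0// addr_ge0.
apply: eq_bigr => z _; rewrite patchE metric_sym.
case: ifPn => zw.
  by rewrite ifT//; apply/mem_set; rewrite ballEmdist.
by rewrite mul0e ifF//; apply/negbTE; apply: contra zw => /set_mem; rewrite ballEmdist.
Qed.

Lemma borel_extension_gradient : borel_fun (EFin \o G).
Proof.
have -> : EFin \o G = (fun w => \sum_(z <- N) ((1 + M%:R) * J z)%:E *
    ((cst 1) \_ (ball z 3%R)) w).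
  by apply/funext => w; rewrite -extension_gradientM/= mule1.
apply: borel_fun_sum => z; apply: borel_fun_scale; apply: borel_fun_restrict.
  by apply: borel_open; exact: open_metric_ball.
exact: borel_cst.
Qed.

Lemma integral_extension_gradientM (W : Y -> \bar R) :
  measurable_fun setT (W : caraT -> \bar R) -> (forall w, 0 <= W w) ->
  \int[cara_measure mu]_w ((G w)%:E * W w) =
  \sum_(z <- N) ((1 + M%:R) * J z)%:E * \int[cara_measure mu]_(w in ball z 3%R) W w.
Proof.
move=> mW W0.
have mWz z : measurable_fun setT (W \_ (ball z 3%R) : caraT -> \bar R).
  apply/(@measurable_restrictT _ _ caraT _ _ W _).1.
    exact: measurable_metric_ball.
  exact: measurable_funTS.
have WB0 z w : 0 <= (W \_ (ball z 3%R)) w by rewrite patchE; case: ifP.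
have c0 z : 0 <= ((1 + M%:R) * J z)%:E by rewrite lee_fin mulr_ge0// addr_ge0.
under eq_integral do rewrite extension_gradientM.
rewrite ge0_integral_sum//.
- by apply: eq_bigr => z _; rewrite ge0_integralZl// -integral_mkcond.
- by move=> z; apply: emeasurable_funM.
- by move=> z w _; rewrite mule_ge0.
Qed.

Lemma extension_continuous : continuous v.
Proof.
move=> x; have G1 : (0 < 1 + G x)%R by rewrite ltr_pwDl.
apply/cvgrPdist_lt => e e0; near=> y.
have xy : (mdist x y < Num.min 1 (e / (1 + G x)))%R.
  near: y; apply/nbhs_ballP; exists (Num.min 1 (e / (1 + G x)))%R => /=.
    by rewrite lt_min ltr01 divr_gt0.
  by move=> z; rewrite ballEmdist.
move: xy; rewrite lt_min => /andP[xy1 xye].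
apply: le_lt_trans (extension_lip J0 aJ Ncover asupp Ncount (w := x) _ xy1) _.
  by rewrite mdistxx.
rewrite ltr_pdivlMr// in xye; apply: le_lt_trans xye.
by rewrite mulrC ler_wpM2l ?mdist_ge0// lerDr.
Unshelve. all: by end_near. Qed.

Lemma extension_bounded_support : bounded_support (EFin \o v).
Proof.
exists o, (r + 3)%R => y /= cy.
have [z [/= vz yz]] := cy (ball y 1%R) (nbhsx_ballx y 1%R ltr01).
move: yz; rewrite !ballEmdist/= => yz.
have : (mdist o z < r + 2)%R.
  rewrite ltNge; apply/negP => oz; move/negP: vz; apply; apply/eqP.
  by rewrite /v (extension_eq0 asupp).
have := metric_triangle o z y; rewrite (metric_sym z y); lra.
Qed.

Lemma extension_integrable : (0 < r)%R ->
  (cara_measure mu).-integrable setT (EFin \o v).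
Proof.
move=> r0; have mv : measurable_fun setT (EFin \o v : caraT -> \bar R).
  apply: borel_fun_cara bmu _ _ _; apply/measurable_EFinP.
  by apply: continuous_borel; exact: extension_continuous.
apply/integrableP; split => //.
pose b := (2 * \sum_(z <- N) `|a z|)%R.
have b0 : (0 <= b)%R by rewrite mulr_ge0// sumr_ge0.
have mb : measurable (ball o (r + 2)%R : set caraT) by exact: measurable_metric_ball.
apply: (@le_lt_trans _ _ (\int[cara_measure mu]_x (((cst b%:E) \_ (ball o (r + 2)%R)) x))).
  apply: ge0_le_integral => //.
  - exact: measurableT_comp.
  - apply/(@measurable_restrictT _ _ caraT _ _ (cst b%:E) mb).1.
    exact: measurable_cst.
  - move=> w _; rewrite patchE; case: ifPn => [_|ow].
      by rewrite lee_fin extension_bounded.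
    rewrite /= /v (extension_eq0 asupp) ?normr0//.
    by rewrite leNgt; apply: contra ow => ow; apply/mem_set; rewrite ballEmdist.
rewrite -integral_mkcond integral_cst// lte_mul_pinfty//.
case: mmu => _ _ ball_fin; apply: ball_fin; by rewrite addr_gt0.
Qed.

Lemma extension_upper_gradient : upper_gradient (EFin \o v) (EFin \o G).
Proof.
apply: local_lipschitz_upper_gradient => //; first exact: borel_extension_gradient.
by move=> w x y wx wy; exact: (extension_lip J0 aJ Ncover asupp Ncount).
Qed.

Lemma sum_abs_le_integral_extension (f : R) :
  (forall z, f%:E <= mu (ball z 2^-1%R)) -> (0 <= f)%R ->
  f%:E * (\sum_(z <- N) `|a z|)%:E <=
  M%:R%:E * (\int[cara_measure mu]_w `|v w|%:E + \int[cara_measure mu]_w (G w)%:E).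
Proof.
move=> Hf f0.
have mv : measurable_fun setT (fun w : caraT => `|v w|%:E : \bar R).
  apply: borel_fun_cara bmu _ _ _; apply/measurable_EFinP.
  apply: measurableT_comp => //.
  by apply: continuous_borel; exact: extension_continuous.
have mG : measurable_fun setT (fun w : caraT => (G w)%:E : \bar R).
  exact: borel_fun_cara bmu _ _ borel_extension_gradient.
rewrite -ge0_integralD//; last first.
  by move=> w _; rewrite lee_fin.
apply: (@le_trans _ _ (\sum_(z <- N) \int[cara_measure mu]_(w in ball z 2^-1%R)
    (`|v w|%:E + (G w)%:E))).
  rewrite -sumEFin ge0_sume_distrr; last by move=> z _; rewrite lee_fin.
  rewrite big_seq [leRHS]big_seq; apply: lee_sum => z zN.
  apply: (@le_trans _ _ (\int[cara_measure mu]_(w in ball z 2^-1%R) `|a z|%:E)).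
    rewrite integral_cst//; last exact: measurable_metric_ball.
    by rewrite muleC; apply: lee_wpmul2l; [rewrite lee_fin|exact: Hf].
  apply: ge0_le_integral => //.
  - exact: measurable_metric_ball.
  - by apply: measurable_funTS; exact: emeasurable_funD.
  - move=> w; rewrite ballEmdist/= => zw; rewrite -EFinD lee_fin.
    by apply: (@extension_lower _ _ N a J o r M J0 aJ Ncover asupp) => //; rewrite metric_sym.
apply: (@sum_ball_integral_le _ _ _ mmu _ _ (fun z => z)).
- exact: emeasurable_funD.
- by move=> w; rewrite -EFinD lee_fin addr_ge0.
- move=> w; apply: leq_trans (Ncount w); rewrite !size_filter.
  apply: sub_count => z /= wz; lra.
Qed.

End ExtensionIntegrals.

(** * Comparison of the integral with a discrete sum *)

Section SumOfMeans.
Context {R : realType} {X : pmetricType R}.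
Variable mu : {outer_measure set X -> \bar R}.
Hypothesis mmu : metric_measure_space mu.
Hypothesis umu : uniform_mms mu.
Local Open Scope ereal_scope.
Local Notation "'Int' f" := (\int[cara_measure mu]_x f x) (at level 10, f at level 9).
Local Notation caraT := (caratheodory_type mu).

Let bmu : borel_regular mu. Proof. by case: mmu. Qed.

Lemma integral_abs_fine (u : X -> \bar R) : (cara_measure mu).-integrable setT u ->
  \int[cara_measure mu]_x `|u x| = \int[cara_measure mu]_x `|fine (u x)|%:E.
Proof.
move=> iu; have /integrableP[mu_ _] := iu.
apply: ge0_ae_eq_integral => //.
- exact: measurableT_comp.
- by apply/measurable_EFinP; apply: measurableT_comp => //; apply: measurableT_comp.
- apply: filterS (integrable_ae measurableT iu) => x /= ux _.
  have {}ux : u x \is a fin_num by exact: ux.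
  by case: (u x) ux.
Qed.

Lemma sobolev_pair_fine (u gu : X -> \bar R) : newton_sobolev11 mu u ->
  min_weak_upper_gradient mu u gu -> sobolev_pair mu (fine \o u) gu.
Proof.
move=> nu mgu; have [iu _] := nu; split.
- have /integrableP[mu_ fin] := iu; apply/integrableP; split.
    by apply/measurable_EFinP; exact: (@measurableT_comp _ _ _ caraT).
  by rewrite -(integral_abs_fine iu).
- exact: min_weak_upper_gradient_fine.
- exact: min_weak_upper_gradient_integrable nu mgu.
Qed.

Lemma sum_ball_mass_le (u : X -> R) (gu : X -> \bar R) (I : Type) (N : seq I)
    (c : I -> X) (D : R) (M : nat) : sobolev_pair mu u gu ->
  (forall x, (size [seq i <- N | (mdist x (c i) < D)%R] <= M)%N) ->
  (\sum_(i <- N) ball_mass mu D gu (c i) <= M%:R * fine (Int gu))%R.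
Proof.
move=> sp NM; have [_ [[bg g0 _] _ _] fin] := sp.
rewrite -lee_fin EFinM fineK; last by rewrite ge0_fin_numE// integral_ge0.
rewrite -sumEFin; under eq_bigr do rewrite -(ball_massE mmu _ _ sp).
by apply: sum_ball_integral_le => //; exact: borel_fun_cara.
Qed.

Section Estimate.
Variables (r C tau : R).
Hypotheses (r0 : (0 < r)%R) (C0 : (0 < C)%R) (tau1 : (1 <= tau)%R).
Hypothesis HP : forall u gu x, sobolev_pair mu u gu ->
  \int[cara_measure mu]_(y in ball x r) `|u y - ball_mean mu r u x|%:E
    <= (C * ball_mass mu (tau * r) gu x)%:E.

Lemma ball_mean_eq0 (u : X -> R) x : (forall y, mdist x y < r -> u y = 0)%R ->
  ball_mean mu r u x = 0%R.
Proof.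
move=> ux; rewrite /ball_mean /avg integral0_eq ?mule0//.
by move=> y; rewrite ballEmdist/= => /ux ->.
Qed.

Lemma integral_le_sum_means (D : R) : quasiconvex X -> (0 < D)%R ->
  exists c1 c2 : R, [/\ (0 <= c1)%R, (0 <= c2)%R &
  forall (u : X -> R) (gu : X -> \bar R) (x0 : X) (R0 : R) (I : eqType) (N : seq I)
    (c : I -> X), sobolev_pair mu u gu -> (0 < R0)%R ->
    (forall y, u y <> 0 -> mdist x0 y < R0)%R ->
    (forall y, (mdist x0 y < R0)%R -> exists2 i, i \in N & (mdist (c i) y < D)%R) ->
    \int[cara_measure mu]_x `|u x|%:E <=
      (c1 * fine (Int gu) + c2 * \sum_(i <- N) `|ball_mean mu r u (c i)|)%:E].
Proof.
move=> qc D0.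
have tr0 : (0 < tau * r)%R by rewrite mulr_gt0// (lt_le_trans _ tau1).
have [K [E [K0 E0 HK]]] := ball_mean_chain mmu r0 C0 tau1 HP umu qc D0.
have [f [g [fg0 _ fg]]] := umu.
have [_ g0] := fg0 _ r0.
have [M1 HM1] := separated_count mmu umu r0 tr0.
have [M2 HM2] := separated_count mmu umu r0 E0.
have [M3 HM3] := separated_count mmu umu r0 D0.
exists (C * M1%:R + g r * (K * M2%:R))%R, (g r * M3%:R)%R; split.
- by rewrite addr_ge0// !mulr_ge0// ltW.
- by rewrite mulr_ge0// ltW.
move=> u gu x0 R0 I N c sp R00 usupp Ncov.
(* The points [c i] need not be separated, so the integral is first discretized on an auxiliary
   [r]-net [S], on which all multiplicities are counted. *)
have [S [sS Sx0 Scov]] := finite_net mmu umu x0 r0 R00.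
pose m := ball_mean mu r u.
have [iu _ _] := sp; have /integrableP[mu_ _] := iu.
have mau (B : set caraT) : measurable_fun B (fun x : caraT => `|u x|%:E : \bar R).
  apply: measurable_funTS; apply/measurable_EFinP; apply: measurableT_comp => //.
  exact/measurable_EFinP.
have mb y : measurable (ball y r : set caraT) by exact: measurable_metric_ball.
have step1 : \int[cara_measure mu]_x `|u x|%:E <=
    \sum_(y <- S) \int[cara_measure mu]_(x in ball y r) `|u x|%:E.
  under eq_bigr do rewrite integral_mkcond.
  have mbu y : measurable_fun setT ((fun x => `|u x|%:E) \_ (ball y r) : caraT -> \bar R).
    exact/(@measurable_restrictT _ _ caraT _ _ _ (mb y)).1.
  rewrite -ge0_integral_sum//; last by move=> y x _; rewrite patchE; case: ifP.
  apply: ge0_le_integral => //; first exact: emeasurable_sum.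
  move=> x _; have [->|/eqP ux] := eqVneq (u x) 0%R.
    by rewrite normr0 sume_ge0// => y _; rewrite patchE; case: ifP.
  have [y yS xy] := Scov x (usupp x ux).
  rewrite (bigD1_seq y)//=; last exact: sS.1.
  rewrite patchE ifT; last by apply/mem_set; rewrite ballEmdist/= metric_sym.
  by rewrite leeDl// sume_ge0// => z _; rewrite patchE; case: ifP.
have step2 y : \int[cara_measure mu]_(x in ball y r) `|u x|%:E <=
    (C * ball_mass mu (tau * r) gu y + g r * `|m y|)%:E.
  apply: (@le_trans _ _ (\int[cara_measure mu]_(x in ball y r)
      (`|u x - m y|%:E + `|m y|%:E))).
    apply: ge0_le_integral => //.
      by apply: emeasurable_funD => //; exact: measurable_dist_cst.
    move=> x _; rewrite -EFinD lee_fin.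
    by rewrite -[X in (`|X| <= _)%R](subrK (m y) (u x)) ler_normD.
  rewrite ge0_integralD//; last exact: measurable_dist_cst.
  rewrite EFinD; apply: leeD; first exact: HP.
  rewrite integral_cst// muleC EFinM; apply: lee_wpmul2r; first by rewrite lee_fin.
  by case: (fg y r r0).
(* The one nearby index [i] is replaced by the sum over all nearby indices, so that the double sum
   can be exchanged and each [i] is charged for at most [M3] points of [S]. *)
have step3 y : y \in S ->
    (`|m y| <= \sum_(i <- N | (mdist (c i) y < D)%R) `|m (c i)| +
      K * ball_mass mu E gu y)%R.
  move=> yS; have [i iN iy] := Ncov y (Sx0 y yS).
  rewrite -[X in (`|X| <= _)%R](subrK (m (c i)) (m y)) addrC.
  apply: le_trans (ler_normD _ _) _; apply: lerD; last first.
    by apply: HK => //; rewrite metric_sym ltW.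
  rewrite (big_rem i)//= iy lerDl sumr_ge0//.
have step4 : (\sum_(y <- S) `|m y| <= M3%:R * \sum_(i <- N) `|m (c i)| +
    K * (M2%:R * fine (Int gu)))%R.
  apply: (@le_trans _ _ (\sum_(y <- S)
      (\sum_(i <- N | (mdist (c i) y < D)%R) `|m (c i)| + K * ball_mass mu E gu y))%R).
    by rewrite big_seq [leRHS]big_seq; exact: ler_sum.
  rewrite big_split/= -mulr_sumr lerD//; last first.
    rewrite ler_wpM2l ?(ltW K0)//; apply: (sum_ball_mass_le (c := id) sp) => x.
    exact: HM2.
  under eq_bigr do rewrite big_mkcond/=.
  rewrite exchange_big/= mulr_sumr; apply: ler_sum => i _.
  rewrite -big_mkcond/=; apply: sum_cst_count => //.
  exact: HM3.
apply: le_trans step1 _.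
apply: (@le_trans _ _ (\sum_(y <- S) (C * ball_mass mu (tau * r) gu y + g r * `|m y|)%:E)).
  by apply: lee_sum => y _; exact: step2.
rewrite sumEFin lee_fin big_split/= -!mulr_sumr.
have step5 : (\sum_(y <- S) ball_mass mu (tau * r) gu y <= M1%:R * fine (Int gu))%R.
  by apply: (sum_ball_mass_le (c := id) sp) => x; exact: HM1.
have := ler_wpM2l (ltW C0) step5; have := ler_wpM2l (ltW g0) step4.
rewrite -/m; lra.
Qed.

End Estimate.
End SumOfMeans.

(** * Transplantation along a quasi-isometry *)

(** The defining inequalities of [L] and [M] concern positive arguments only; at [t = 0] the term
    [rho B] of the constant does the work, as [rho 0 = 1]. *)
Lemma control_function_affine (R : realType) (rho : R -> R) (A B : R) :
  control_function rho -> 0 < A -> 0 < B ->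
  exists2 c : R, 0 < c & forall t, 0 <= t -> rho (A * t + B) <= c * rho t.
Proof.
move=> crho A0 B0; have ge1 := control_function_ge1 crho.
have [_ _ r01 [L [M [LM HLM]]]] := crho.
have [LB _] := LM B B0; have [_ MA] := LM A A0.
exists (L B * M A + rho B).
  by rewrite ltr_pwDl ?mulr_gt0// (le_trans ler01)// ge1// ltW.
move=> t; rewrite le_eqVlt => /predU1P[<-|t0].
  by rewrite mulr0 add0r r01 mulr1 lerDr mulr_ge0// ltW.
have At : 0 < A * t by rewrite mulr_gt0.
have [H _] := HLM _ _ At B0; have [_ H'] := HLM _ _ t0 A0.
rewrite addrC; apply: le_trans H _; rewrite mulrDl.
apply: (@le_trans _ _ (L B * (M A * rho t))).
  by apply: ler_wpM2l => //; rewrite ltW.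
rewrite mulrA lerDl mulr_ge0// (le_trans ler01)// ge1// ltW//.
Qed.

Section Transplant.
Context {R : realType} {X Y : pmetricType R}.
Variable mu : {outer_measure set X -> \bar R}.
Variable nu : {outer_measure set Y -> \bar R}.
Hypothesis mmu : metric_measure_space mu.
Hypothesis mnu : metric_measure_space nu.
Hypothesis umu : uniform_mms mu.
Hypothesis unu : uniform_mms nu.
Variables (h : Y -> X) (A : R).
Hypothesis A1 : 1 <= A.
Hypothesis hup : forall z w, mdist (h z) (h w) <= A * mdist z w + A.
Hypothesis hlow : forall z w, mdist z w <= A * mdist (h z) (h w) + A.
Hypothesis hcob : forall x, exists z, mdist x (h z) <= A.
Variable rho : R -> R.
Hypothesis crho : control_function rho.
Local Notation "'IntX' f" := (\int[cara_measure mu]_x f x)%E (at level 10, f at level 9).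

Let bmu : borel_regular mu. Proof. by case: mmu. Qed.
Let A0 : 0 < A. Proof. by rewrite (lt_le_trans _ A1). Qed.

(** Points whose images lie within [D] of [x] are, by the lower quasi-isometry bound, within a fixed
    distance of any one of them. Indices are counted rather than images, as [h] may fail to be
    injective. *)
Lemma separated_image_count (D : R) : 0 < D -> exists M : nat,
  forall N x, separated_seq 1 N -> (size [seq z <- N | (mdist x (h z) < D)%R] <= M)%N.
Proof.
move=> D0; have P0 : 0 < A * (2 * D) + A + 1 by rewrite !addr_gt0// !mulr_gt0.
have [M HM] := separated_multiplicity mnu unu ltr01 P0.
exists M => N x sN; set F := [seq z <- N | _].
have sF : separated_seq 1 F by exact: separated_filter.
case FE : F => [//|z0 F']; rewrite -FE.
have z0F : z0 \in F by rewrite FE mem_head.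
apply: (HM _ z0) => // z zF.
move: z0F zF; rewrite !mem_filter /= => /andP[xz0 _] /andP[xz _].
apply: le_lt_trans (hlow z0 z) _.
have : mdist (h z0) (h z) <= 2 * D.
  have := metric_triangle (h z0) x (h z); rewrite (metric_sym (h z0) x); lra.
move=> /(ler_wpM2l (ltW A0)); lra.
Qed.

Section Weighted.
Variables (p' : Y) (E : R).
Hypothesis E0 : 0 < E.
Local Open Scope ereal_scope.

(** The weight on the ball about [z] is at most [s], a value of [rho] at an affine function of
    [mdist (h p') (h z)]; moving from [h z] to a point [x] of its ball costs [A * E] in the
    argument, and [control_function_affine] returns to the weight at [x]. *)
Lemma ball_mass_weight : exists2 c : R, (0 <= c)%R &
  forall u gu z, sobolev_pair mu u gu ->
  (ball_mass mu E gu (h z))%:E *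
    \int[cara_measure nu]_(w in ball z 3%R) (rho (mdist p' w))%:E <=
  c%:E * \int[cara_measure mu]_(x in ball (h z) E)
    (gu x * (rho (mdist (h p') x))%:E).
Proof.
have B0 : (0 < A * E + A + 3)%R by rewrite !addr_gt0// mulr_gt0.
have [c c0 Hc] := control_function_affine crho A0 B0.
have [f [g [fg0 _ fg]]] := unu.
have three0 : (0 < 3 :> R)%R by [].
have [_ g0] := fg0 _ three0.
have [rho0 mono _ _] := crho.
exists (g 3 * c)%R; first by rewrite mulr_ge0// ltW.
move=> u gu z sp; have [_ [[bg gu0 _] _ _] _] := sp.
pose s := rho (A * mdist (h p') (h z) + A + 3)%R.
have s0 : (0 <= s)%R.
  by apply: rho0; rewrite !addr_ge0// ?mulr_ge0 ?mdist_ge0// ltW.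
have mW x (D : set (caratheodory_type mu)) :
    measurable_fun D (fun y => (rho (mdist x y))%:E : \bar R).
  by apply: borel_fun_cara => //; exact: control_function_borel.
have bnu : borel_regular nu by case: mnu.
apply: (@le_trans _ _ ((ball_mass mu E gu (h z))%:E * (s * g 3)%:E)).
  apply: lee_wpmul2l; first by rewrite lee_fin (ball_mass_ge0 _ _ sp).
  apply: (@le_trans _ _ (\int[cara_measure nu]_(w in ball z 3%R) s%:E)).
    apply: ge0_le_integral => //.
    - exact: measurable_metric_ball.
    - by move=> w _; rewrite lee_fin rho0// mdist_ge0.
    - by apply: borel_fun_cara => //; exact: control_function_borel.
    - move=> w; rewrite ballEmdist/= => zw; rewrite lee_fin; apply: mono.
        exact: mdist_ge0.
      have := metric_triangle p' z w; have := hlow p' z; lra.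
  rewrite integral_cst; last exact: measurable_metric_ball.
  rewrite EFinM; apply: lee_wpmul2l; first by rewrite lee_fin.
  by case: (fg z _ three0).
rewrite -(ball_massE mmu _ _ sp) mulrC EFinM muleCA EFinM -muleA.
apply: lee_wpmul2l; first by rewrite lee_fin ltW.
have mB : measurable (ball (h z) E : set (caratheodory_type mu)) by exact: measurable_metric_ball.
have mgu : measurable_fun (ball (h z) E : set (caratheodory_type mu)) (gu : caratheodory_type mu -> \bar R).
  exact: borel_fun_cara.
rewrite muleC -ge0_integralZl//.
rewrite -ge0_integralZl//; last 3 first.
- by apply: emeasurable_funM.
- by move=> x _; rewrite mule_ge0// lee_fin rho0// mdist_ge0.
- by rewrite lee_fin ltW.
apply: ge0_le_integral => //.
- by move=> x _; rewrite mule_ge0// lee_fin.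
- by apply: emeasurable_funM.
- by apply: emeasurable_funM => //; apply: emeasurable_funM.
move=> x; rewrite ballEmdist/= => zx.
rewrite muleCA muleC; apply: lee_wpmul2l => //.
rewrite -EFinM lee_fin; apply: le_trans (Hc _ (mdist_ge0 _ _)).
apply: mono; first by rewrite !addr_ge0// ?mulr_ge0 ?mdist_ge0// ltW.
have : (mdist (h p') (h z) <= mdist (h p') x + E)%R.
  have := metric_triangle (h p') x (h z); rewrite (metric_sym x); lra.
move=> /(ler_wpM2l (ltW A0)); lra.
Qed.

End Weighted.
Lemma sobolev11_transplant : quasiconvex X -> local_weak_poincare11 mu ->
  sobolev11 nu rho -> sobolev11 mu rho.
Proof.
move=> qc pmu [C' [p' [C'gt0 HS]]].
have [r [C [tau [r0 C0 tau1 HP]]]] := poincare_mean mmu umu pmu.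
(* [h] sends points at distance less than 4 to points within [4 * A + A]. For [3 * A]: a point of
   [X] is within [A] of some image, whose preimage is within 1 of the net, and [h] moves that by at
   most [2 * A]. *)
have A50 : 0 < 5 * A by rewrite mulr_gt0.
have A30 : 0 < 3 * A by rewrite mulr_gt0.
have [K [E [K0 E0 HK]]] := ball_mean_chain mmu r0 C0 tau1 HP umu qc A50.
have [c1 [c2 [c10 c20 Hsum]]] := integral_le_sum_means mmu umu r0 C0 tau1 HP qc A30.
have three0 : 0 < 3 :> R by [].
have [M HM] := separated_count mnu unu ltr01 three0.
have [M2 HM2] := separated_image_count E0.
have [cw cw0 Hcw] := ball_mass_weight p' E0.
have [f [g [fg0 _ fg]]] := unu.
have half0 : 0 < 2^-1 :> R by rewrite invr_gt0.
have [f0 _] := fg0 _ half0.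
pose c3 := (1 + M%:R) * K * cw * M2%:R.
have c30 : 0 <= c3 by rewrite !mulr_ge0// ?addr_ge0// ltW.
pose c4 := (f 2^-1)^-1 * (M%:R * ((C' + 1) * c3)).
have c40 : 0 <= c4 by rewrite !mulr_ge0// ?invr_ge0 ?addr_ge0// ltW.
have Ctot0 : 0 < c1 + c2 * c4 + 1 by rewrite ltr_wpDl// addr_ge0// mulr_ge0.
exists (c1 + c2 * c4 + 1), (h p'); split => // u gu nu_u bu mgu.
have sp := sobolev_pair_fine mmu nu_u mgu.
have [iu _] := nu_u.
have [[bgu gu0 _] _ _] := mgu.
rewrite (integral_abs_fine iu).
pose w0 : X -> R := fine \o u.
have [x0 [R0 Hsupp]] := bu.
pose R0' := Num.max R0 1.
have R0'0 : 0 < R0' by rewrite lt_max ltr01 orbT.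
have usupp y : w0 y <> 0 -> mdist x0 y < R0'.
  move=> uy; have : closure [set y | (u y != 0)%E] y.
    by apply: subset_closure => /=; apply/eqP => u0; apply: uy; rewrite /w0/= u0.
  by move=> /Hsupp; rewrite ballEmdist/= => H; rewrite lt_max H.
(* If [z] is at least [R2] away from [p'], the averaging ball about [h z] misses the support of [u].
   Radius [R3] reaches some [z1] whose image is within [A] of any given point of that support. The
   net covers both ranges, with the margin 6 required by the interpolation. *)
pose R2 := A * (mdist (h p') x0 + R0' + r) + A.
pose R3 := A * (mdist (h p') x0 + R0' + A) + A.
have d0 := mdist_ge0 (h p') x0.
have R20 : 0 < R2 by apply: addr_gt0 => //; apply: mulr_gt0 => //; lra.
have R30 : 0 < R3 by apply: addr_gt0 => //; apply: mulr_gt0 => //; lra.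
have R10 : 0 < R2 + 6 + R3 by lra.
have [N [sN No Ncov]] := finite_net mnu unu p' ltr01 R10.
pose a (z : Y) : R := ball_mean mu r w0 (h z).
pose J (z : Y) : R := K * ball_mass mu E gu (h z).
have J0 z : 0 <= J z by rewrite mulr_ge0 ?(ball_mass_ge0 _ _ sp)// ltW.
have aJ : {in N &, forall z z', mdist z z' < 4 -> `|a z - a z'| <= J z}.
  move=> z z' _ _ zz'; apply: HK => //; apply: le_trans (hup z z') _.
  have := ler_wpM2l (ltW A0) (ltW zz'); lra.
have Ncover w : mdist p' w < R2 + 6 -> exists2 z, z \in N & mdist w z < 1.
  by move=> H; apply: Ncov; rewrite ltr_wpDr// ltW.
have asupp : {in N, forall z, R2 <= mdist p' z -> a z = 0}.
  move=> z _ R2z; apply: ball_mean_eq0 => y zy.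
  apply: contrapT => /usupp x0y.
  have : mdist (h p') (h z) < mdist (h p') x0 + R0' + r.
    have := metric_triangle (h p') x0 (h z); have := metric_triangle x0 y (h z).
    rewrite (metric_sym y); lra.
  rewrite -(ltr_pM2l A0) => H; have := hlow p' z; rewrite /R2 in R2z; lra.
have Ncount w := HM N w sN.
have uG := extension_upper_gradient J0 aJ Ncover asupp Ncount.
have iv := extension_integrable mnu J0 aJ Ncover asupp Ncount R20.
have bv := extension_bounded_support asupp.
set v := extension N a in uG iv bv.
set G := extension_gradient N J M in uG.
have G0 w : 0 <= G w by exact: extension_gradient_ge0.
have bnu : borel_regular nu by case: mnu.
have [rho0 _ _ _] := crho.
have rhop (Z : pmetricType R) (x y : Z) : (0 <= (rho (mdist x y))%:E)%E.
  by rewrite lee_fin rho0// mdist_ge0.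
have mrho : measurable_fun setT (fun w : caratheodory_type nu => (rho (mdist p' w))%:E : \bar R).
  by apply: borel_fun_cara => //; exact: control_function_borel.
have mG : measurable_fun setT (fun w : caratheodory_type nu => (G w)%:E : \bar R).
  by have [bG _ _] := uG; exact: borel_fun_cara bnu _ _ bG.
pose IG := (\int[cara_measure nu]_w ((G w)%:E * (rho (mdist p' w))%:E))%E.
pose IW := (\int[cara_measure mu]_x (gu x * (rho (mdist (h p') x))%:E))%E.
(* Only finiteness matters here: [G] is a finite combination of indicators of balls of finite
   measure. The bound uniform in [u] is [IGW]. *)
have fG : (\int[cara_measure nu]_w (G w)%:E < +oo)%E.
  under eq_integral do rewrite -[(G _)%:E]mule1.
  rewrite (integral_extension_gradientM mnu N M J0 (W := cst 1%E))//.
  apply: lte_sum_pinfty => z _; apply: lte_mul_pinfty => //.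
    by rewrite lee_fin mulr_ge0// addr_ge0.
  rewrite integral_cst; last exact: measurable_metric_ball.
  by rewrite mul1e; case: mnu => _ _; exact.
have vG := sobolev_upper_gradient mnu unu crho C'gt0 HS iv bv uG fG.
have GG : (\int[cara_measure nu]_w (G w)%:E <= IG)%E.
  apply: ge0_le_integral => //.
  - by move=> w _; rewrite lee_fin.
  - exact: emeasurable_funM.
  - move=> w _; rewrite -EFinM lee_fin ler_peMr//.
    by apply: control_function_ge1 => //; exact: mdist_ge0.
have IGW : (IG <= c3%:E * IW)%E.
  rewrite /IG (integral_extension_gradientM mnu N M J0 mrho)//.
  apply: (@le_trans _ _ (\sum_(z <- N) ((1 + M%:R) * K * cw)%:E *
     \int[cara_measure mu]_(x in ball (h z) E) (gu x * (rho (mdist (h p') x))%:E))%E).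
    apply: lee_sum => z _; rewrite /J mulrA !EFinM -!muleA.
    apply: lee_wpmul2l; first by rewrite lee_fin addr_ge0.
    apply: lee_wpmul2l; first by rewrite lee_fin ltW.
    exact: Hcw sp.
  have nng x : (0 <= gu x * (rho (mdist (h p') x))%:E)%E by rewrite mule_ge0.
  rewrite -ge0_sume_distrr; last by move=> z _; exact: integral_ge0.
  rewrite /c3 [X in (_ <= X * IW)%E]EFinM -[leRHS]muleA; apply: lee_wpmul2l.
    by rewrite lee_fin !mulr_ge0// ?addr_ge0// ltW.
  apply: sum_ball_integral_le => //; last by move=> x; exact: HM2.
  apply: emeasurable_funM; apply: borel_fun_cara => //.
  exact: control_function_borel.
have sumabs : ((f 2^-1)%:E * (\sum_(z <- N) `|a z|)%:E <= (M%:R * ((C' + 1) * c3))%:E * IW)%E.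
  apply: le_trans (sum_abs_le_integral_extension mnu J0 aJ Ncover asupp Ncount _ _) _.
  - by move=> z; case: (fg z _ half0).
  - exact: ltW.
  rewrite EFinM -muleA; apply: lee_wpmul2l; first by rewrite lee_fin.
  apply: (@le_trans _ _ (C'%:E * IG + IG)%E); first exact: leeD.
  rewrite EFinM -muleA EFinD ge0_muleDl ?lee_fin ?(ltW C'gt0)// mul1e.
  apply: leeD => //; apply: lee_wpmul2l => //; by rewrite lee_fin ltW.
have guW : (IntX gu <= IW)%E.
  apply: ge0_le_integral => //.
  - exact: borel_fun_cara.
  - apply: emeasurable_funM; apply: borel_fun_cara => //.
    exact: control_function_borel.
  - move=> x _; rewrite lee_pemulr//.
    by rewrite lee_fin; apply: control_function_ge1 => //; exact: mdist_ge0.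
have [_ _ fgu] := sp.
have IW0 : (0 <= IW)%E by apply: integral_ge0 => x _; rewrite mule_ge0.
have main := Hsum w0 gu x0 R0' Y N h sp R0'0 usupp _.
apply: le_trans (main _) _ => {main}.
  move=> y x0y; have [z1 yz1] := hcob y.
  have [|z zN z1z] := Ncov z1.
    have : mdist (h p') (h z1) <= mdist (h p') x0 + R0' + A.
      have := metric_triangle (h p') x0 (h z1); have := metric_triangle x0 y (h z1); lra.
    move=> /(ler_wpM2l (ltW A0)); have := hlow p' z1; rewrite /R3; lra.
  exists z => //; have := hup z1 z; have := metric_triangle (h z) (h z1) y.
  rewrite (metric_sym (h z) (h z1)) (metric_sym (h z1) y).
  have : A * mdist z1 z < A * 1 by rewrite ltr_pM2l.
  lra.
rewrite -/IW.
(* If the weighted integral is infinite the inequality is trivial, the constant being positive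
   thanks to its summand 1; otherwise everything is real arithmetic. *)
clearbody IW; clear IGW; case: IW guW sumabs IW0 => [iw| |]; last by [].
- rewrite -!EFinM !lee_fin => guW sumabs iw0.
  have igw : fine (IntX gu) <= iw.
    by rewrite -lee_fin fineK// ge0_fin_numE// integral_ge0.
  have sumabs' : \sum_(z <- N) `|a z| <= c4 * iw.
    by rewrite /c4 -mulrA ler_pdivlMl.
  have := ler_wpM2l c10 igw; have := ler_wpM2l c20 sumabs'.
  rewrite -/w0 -/a; lra.
- by move=> _ _ _; rewrite gt0_muley ?lte_fin// leey.
Qed.

End Transplant.

(** * Quasi-inverses and both implications *)

Lemma quasi_isometry_inverse (R : realType) (X X' : pmetricType R) :
  quasi_isometric X X' -> exists (f : X -> X') (h : X' -> X) (A : R),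
    [/\ 1 <= A,
      (forall x y, mdist (f x) (f y) <= A * mdist x y + A) /\
      (forall x y, mdist x y <= A * mdist (f x) (f y) + A),
      (forall x y, mdist (h x) (h y) <= A * mdist x y + A) /\
      (forall x y, mdist x y <= A * mdist (h x) (h y) + A),
      forall x', exists x, mdist x' (f x) <= A &
      forall x, exists x', mdist x (h x') <= A].
Proof.
move=> [f [lam [kap [lam1 kap0 fqi fcob]]]].
have lam0 : 0 < lam by rewrite (lt_le_trans _ lam1).
have flow x y : mdist x y <= lam * mdist (f x) (f y) + lam * kap.
  have [H _] := fqi x y; rewrite -mulrDr -ler_pdivrMl//.
  by rewrite -lerBlDr.
have /choice[h Hh] : forall x', exists x, mdist x' (f x) < kap.
  move=> x'; have : [set x' | inf [set mdist x' y | y in range f] < kap] x' by rewrite fcob.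
  move=> /= lt; have ne : [set mdist x' y | y in range f] !=set0.
    exists (mdist x' (f (point : X))) => /=; exists (f (point : X)) => //.
    by exists (point : X).
  by have [_ [_ [x _ <-] <-] {}lt] := inf_lt ne lt; exists x.
(* One constant for all estimates: passing through [f] costs [2 * kap] for the errors of [h] at both
   ends, and inverting [f] multiplies by [lam] and adds [lam * kap], whence [3 * lam * kap]. *)
have [A AE] : exists A, A = lam + 3 * lam * kap + kap by eexists.
have lk : 0 <= lam * kap by rewrite mulr_ge0// ltW.
have klk : kap <= lam * kap by rewrite ler_peMl.
have lamA : lam <= A by lra.
have A1 : 1 <= A by exact: le_trans lamA.
have scale t : 0 <= t -> lam * t <= A * t by move=> t0; rewrite ler_wpM2r.
have fh x' y' : mdist (f (h x')) (f (h y')) <= mdist x' y' + 2 * kap.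
  have := metric_triangle (f (h x')) x' (f (h y')).
  have := metric_triangle x' y' (f (h y')).
  have := Hh x'; have := Hh y'; rewrite (metric_sym (f (h x')) x'); lra.
exists f, h, A; split => //.
- split=> x y.
    have [_ H] := fqi x y; have := scale _ (mdist_ge0 x y); lra.
  have := flow x y; have := scale _ (mdist_ge0 (f x) (f y)); lra.
- split=> x' y'.
    have := flow (h x') (h y'); have := scale _ (mdist_ge0 x' y').
    have := ler_wpM2l (ltW lam0) (fh x' y'); lra.
  have := scale _ (mdist_ge0 (h x') (h y')).
  have [_] := fqi (h x') (h y'); have := Hh x'; have := Hh y'.
  have := metric_triangle x' (f (h x')) y'.
  have := metric_triangle (f (h x')) (f (h y')) y'.
  rewrite (metric_sym (f (h y')) y'); lra.
- by move=> x'; exists (h x'); have := Hh x'; lra.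
- move=> x; exists (f x); have := flow x (h (f x)).
  by have := ler_wpM2l (ltW lam0) (ltW (Hh (f x))); lra.
Qed.

Theorem corollaryC (R : realType) (rho : R -> R) (X X' : pmetricType R)
    (mu : {outer_measure set X -> \bar R})
    (mu' : {outer_measure set X' -> \bar R}) :
  control_function rho ->
  metric_measure_space mu -> quasiconvex X -> uniform_mms mu ->
  local_weak_poincare11 mu ->
  metric_measure_space mu' -> quasiconvex X' -> uniform_mms mu' ->
  local_weak_poincare11 mu' ->
  quasi_isometric X X' ->
  (sobolev11 mu rho <-> sobolev11 mu' rho).
Proof.
move=> crho mmu qX umu pmu mmu' qX' umu' pmu' /quasi_isometry_inverse.
move=> [f [h [A [A1 [f1 f2] [h1 h2] fcob hcob]]]]; split.
  (* The transfer runs along a map from the space where the inequality is known to the one where it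
     is wanted: [f] for this implication, [h] for the other. *)
  exact: (sobolev11_transplant mmu' mmu umu' umu A1 f1 f2 fcob crho qX' pmu').
exact: (sobolev11_transplant mmu mmu' umu umu' A1 h1 h2 hcob crho qX pmu).
Qed.
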